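(* Let $n,m\ge 1$ and consider the series interconnection \[ \dot x^1 = f^1(t,x^1),\qquad \dot x^2 = f^2(t,x^2,x^1), \] with $x^1\in\mathbb{R}^n$, $x^2\in\mathbb{R}^m$, where $f^1,f^2$ are $C^1$ and the trajectories evolve in a convex state space $\Omega^1\times\Omega^2\subseteq\mathbb{R}^n\times\mathbb{R}^m$. Write $x=(x^1,x^2)$ and $J^{ij}:=\frac{\partial}{\partial x^j}f^i$, so that the Jacobian of the system is \[ J(t,x)=\begin{bmatrix}J^{11}(t,x^1) & 0\\ J^{21}(t,x) & J^{22}(t,x)\end{bmatrix}. \] Assume that $J^{21}(t,x)$ is uniformly bounded for all $x\in\Omega^1\times\Omega^2$ and $t\ge 0$. Fix $k\in\{1,\dots,n+m\}$ and let $i_1:=\max\{0,k-n\}$, $i_2:=\min\{m,k\}$. Suppose there exist matrix measures $\mu_i$ induced by (possibly different) $L_p$ vector norms and constants $\eta_i>0$ such that \[ \mu_i\big((J^{11}(t,x^1))^{[k-i]}\big)+\mu_i\big((J^{22}(t,x))^{[i]}\big)\le -\eta_i<0 \] for all $i\in\{i_1,\dots,i_2\}$, all $x\in\Omega^1\times\Omega^2$ and all $t\ge 0$. Then the system is $k$-contracting.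
   Context: Compounds: for $C\in\mathbb{R}^{p\times q}$ and $k\le\min\{p,q\}$, the $k$th multiplicative compound $C^{(k)}$ is the $\binom{p}{k}\times\binom{q}{k}$ matrix of all $k\times k$ minors of $C$, rows and columns indexed by increasing $k$-tuples of indices in lexicographic order. For a square matrix $A$, the $k$th additive compound is $A^{[k]}:=\frac{d}{dt}(\exp(At))^{(k)}\big|_{t=0}$. By convention, for a square matrix $M$, $M^{(0)}:=1$ and $M^{[0]}:=0$ (a $1\times 1$ matrix). Matrix measure: for a vector norm $|\cdot|$ with induced matrix norm $\|\cdot\|$, $\mu(A):=\lim_{\varepsilon\to0^+}(\|I+\varepsilon A\|-1)/\varepsilon$. $k$-contraction: for a system $\dot z=F(t,z)$, $F$ of class $C^1$, whose trajectories $z(t,a)$ (with $z(0)=a$) evolve in a convex set $D\subseteq\mathbb{R}^N$, let $\Phi_a(t)$ solve $\dot\Phi=\frac{\partial F}{\partial z}(t,z(t,a))\Phi$, $\Phi_a(0)=I_N$. The system is called $k$-contracting if there exist $\eta>0$ and a norm on $\mathbb{R}^{\binom{N}{k}}$ with induced matrix norm $\|\cdot\|$ such that $\|(\Phi_a(t))^{(k)}\|\le e^{-\eta t}$ for all $t\ge0$ and $a\in D$ (i.e., the variational dynamics contract the volume of $k$-dimensional parallelotopes at an exponential rate). *)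

(* Defs.v *)
From HB Require Import structures.
From mathcomp Require Import all_boot all_order all_algebra.
From mathcomp Require Import all_classical all_reals all_analysis.
Set Implicit Arguments. Unset Strict Implicit. Unset Printing Implicit Defensive.
Import Order.TTheory GRing.Theory Num.Theory.
Import numFieldNormedType.Exports.
Local Open Scope classical_set_scope.
Local Open Scope ring_scope.

Section Defs.
Variable R : realType.

(** Index set of the k-th compound: k-element subsets of {0,..,p-1}
    (i.e. increasing k-tuples of indices); there are 'C(p,k) of them. *)
Definition ksub (p k : nat) := {S : {set 'I_p} | #|S| == k}.

Definition ksub_idx (p k : nat) (S : ksub p k) : 'I_k -> 'I_p :=
  fun i => enum_val (cast_ord (esym (eqP (valP S))) i).

Definition mcomp (p q k : nat) (C : 'M[R]_(p, q)) :
    'M[R]_(#|{: ksub p k}|, #|{: ksub q k}|) :=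
  \matrix_(I, J) \det (mxsub (ksub_idx (enum_val I)) (ksub_idx (enum_val J)) C).

Definition mexp (p : nat) (A : 'M[R]_p) : 'M[R]_p :=
  limn (series (fun j : nat => (j`!%:R)^-1 *: A ^+ j)).

Definition acomp (p k : nat) (A : 'M[R]_p) : 'M[R]_(#|{: ksub p k}|) :=
  derive1 (fun t : R => mcomp k (mexp (t *: A))) 0.

Definition is_norm (d : nat) (nu : 'cV[R]_d -> R) :=
  [/\ forall x, 0 <= nu x,
      forall x, nu x = 0 -> x = 0,
      forall (a : R) x, nu (a *: x) = `|a| * nu x
    & forall x y, nu (x + y) <= nu x + nu y].

Definition indnorm (d : nat) (nu : 'cV[R]_d -> R) (A : 'M[R]_d) : R :=
  sup [set nu (A *m x) | x in [set x | nu x = 1]].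

Definition mxmeasure (d : nat) (nu : 'cV[R]_d -> R) (A : 'M[R]_d) : R :=
  lim ((fun e : R => (indnorm nu (1%:M + e *: A) - 1) / e) @ 0^'+).

Definition lpnorm (p : \bar R) (d : nat) (x : 'cV[R]_d) : R :=
  match p with
  | r%:E => (\sum_i `|x i 0| `^ r) `^ r^-1
  | +oo%E => \big[Num.max/0]_i `|x i 0|
  | -oo%E => 0
  end.

Definition convex_rV (N : nat) (D : set 'rV[R]_N) :=
  forall x y (l : R), D x -> D y -> 0 <= l <= 1 -> D (l *: x + (1 - l) *: y).

(** C^1 : differentiable everywhere, with continuous derivative
    (continuity of p |-> 'd G p v for every direction v; finite dimension). *)
Definition C1 (U V : normedModType R) (G : U -> V) :=
  (forall p, differentiable G p) /\ (forall v, continuous (fun p => 'd G p v)).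

(** Jacobian matrix (column-vector convention): entry (i,j) = d g_i / d x_j. *)
Definition pjac (a b : nat) (g : 'rV[R]_a -> 'rV[R]_b) (x : 'rV[R]_a) : 'M[R]_(b, a) :=
  \matrix_(i, j) ('d g x (delta_mx 0 j)) 0 i.

Definition is_traj (N : nat) (F : R -> 'rV[R]_N -> 'rV[R]_N) (z : R -> 'rV[R]_N) :=
  z @ 0^'+ --> z 0 /\ forall t : R, 0 < t -> is_derive t (1 : R) z (F t (z t)).

Definition is_var_sol (N : nat) (F : R -> 'rV[R]_N -> 'rV[R]_N)
    (z : R -> 'rV[R]_N) (Phi : R -> 'M[R]_N) :=
  [/\ Phi 0 = 1%:M, Phi @ 0^'+ --> Phi 0
    & forall t : R, 0 < t -> is_derive t (1 : R) Phi (pjac (F t) (z t) *m Phi t)].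

Definition k_contracting (N k : nat) (F : R -> 'rV[R]_N -> 'rV[R]_N)
    (D : set 'rV[R]_N) :=
  exists2 eta : R, 0 < eta &
  exists2 nu : 'cV[R]_(#|{: ksub N k}|) -> R, is_norm nu &
  forall (a : 'rV[R]_N) (z : R -> 'rV[R]_N) (Phi : R -> 'M[R]_N),
    D a -> z 0 = a -> is_traj F z -> (forall t, 0 <= t -> D (z t)) ->
    is_var_sol F z Phi ->
    forall t, 0 <= t -> indnorm nu (mcomp k (Phi t)) <= expR (- (eta * t)).

Definition series_sys (n m : nat) (f1 : R -> 'rV[R]_n -> 'rV[R]_n)
    (f2 : R -> 'rV[R]_m -> 'rV[R]_n -> 'rV[R]_m) :
    R -> 'rV[R]_(n + m) -> 'rV[R]_(n + m) :=
  fun t x => row_mx (f1 t (lsubmx x)) (f2 t (rsubmx x) (lsubmx x)).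

Definition prod_set (n m : nat) (O1 : set 'rV[R]_n) (O2 : set 'rV[R]_m) :
    set 'rV[R]_(n + m) := [set x | O1 (lsubmx x) /\ O2 (rsubmx x)].

End Defs.

(* Main.v *)
Require Import Defs.
From HB Require Import structures.
From mathcomp Require Import all_boot all_order all_algebra fingroup perm ring lra.
From mathcomp Require Import all_classical all_reals all_analysis.
Import Order.TTheory GRing.Theory Num.Theory.
Import numFieldNormedType.Exports.
Local Open Scope classical_set_scope.
Local Open Scope ring_scope.
Set Implicit Arguments. Unset Strict Implicit. Unset Printing Implicit Defensive.

(** Write [w f] for the value of the [k]-vector [w = (Phi t)^(k) v] on an
    arbitrary index map [f : 'I_k -> 'I_(n + m)]; it is alternating in [f].
    Maps with [k - i] indices in the first block and [i] in the second give a
    matrix [W_i], and multiplying [Phi] by [diag(A, B)] turns [W_i] into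
    [A^(k-i) W_i (B^(i))^T], a two-step Cauchy-Binet expansion. The entrywise
    [L_p] norm of [W_i] then grows under [diag(J11, J22)] at rate at most
    [mu(J11^[k-i]) + mu(J22^[i])]. Rescaling the second block by a small [delta]
    replaces [J21] by [delta J21], whose effect on the sum over [i] of these
    norms is [O(delta)] because minors are Lipschitz near the identity. So the
    sum of the norms has upper Dini derivative at most a negative multiple of
    itself along every trajectory. *)

(** * Cauchy-Binet for alternating functions of the rows *)

(** Norms are not differentiable, so growth is estimated on short steps: to first order, the
    solution at [t + h] is a product of two factors near the identity applied to the solution at
    [t], and each factor is bounded multiplicatively. The block-diagonal factor acts on each [W_i]
    separately, so the exponents may differ from one [i] to another. Within one [W_i] the entrywise
    norm has a single exponent, so that left and right multiplication are both controlled by the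
    induced norms for that exponent. The factor from [J21] mixes the [W_i], about whose relative
    sizes nothing is known; hence it must be made small. Its Lipschitz constant is uniform in the
    [k]-vector, thus unaffected by the rescaling, and [delta] can be chosen after it. Solutions are
    differentiable only at positive times and right continuous at 0, so the growth estimate is
    available only for [t > 0], and the comparison with an exponential must start strictly above the
    initial value. *)

Lemma inj_same_image_perm (k : nat) (T : finType) (f g : 'I_k -> T) :
  injective f -> injective g -> (f @: 'I_k = g @: 'I_k)%SET ->
  exists s : 'S_k, f = g \o s.
Proof.
move=> fi gi fg.
have ex r : exists r', g r' == f r.
  have : f r \in (g @: 'I_k)%SET by rewrite -fg; apply: imset_f.
  by case/imsetP => r' _ ->; exists r'.
have si : injective (fun r => xchoose (ex r)).
  move=> r1 r2 e; apply: fi.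
  by rewrite -(eqP (xchooseP (ex r1))) -(eqP (xchooseP (ex r2))) e.
exists (perm si); apply/funext => r /=.
by rewrite permE (eqP (xchooseP (ex r))).
Qed.

Definition kidx (p k : nat) (I : 'I_(#|{: ksub p k}|)) : 'I_k -> 'I_p :=
  ksub_idx (enum_val I).

Definition Ksub (p k : nat) (S : {set 'I_p}) (Sk : #|S| == k) : ksub p k :=
  exist _ S Sk.

Lemma kidx_inj (p k : nat) (I : 'I_(#|{: ksub p k}|)) : injective (kidx I).
Proof. by move=> a b /enum_val_inj/cast_ord_inj. Qed.

Lemma image_ksub_idx (p k : nat) (S : ksub p k) : (ksub_idx S @: 'I_k)%SET = val S.
Proof.
apply/setP => x; apply/imsetP/idP => [[a _ ->]|xS]; first exact: enum_valP.
exists (cast_ord (eqP (valP S)) (enum_rank_in xS x)) => //.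
by rewrite /ksub_idx cast_ordK enum_rankK_in.
Qed.

Lemma mem_kidx_rank (p k : nat) (S : ksub p k) (r : 'I_k) :
  kidx (enum_rank S) r \in val S.
Proof. by rewrite -image_ksub_idx /kidx enum_rankK; apply: imset_f. Qed.

Lemma ksub_of_inj (p k : nat) (f : 'I_k -> 'I_p) : injective f ->
  exists I : 'I_(#|{: ksub p k}|), exists s : 'S_k, f = kidx I \o s.
Proof.
move=> fi; have Sk : #|(f @: 'I_k)%SET| == k by rewrite card_imset // card_ord.
exists (enum_rank (Ksub Sk)).
apply: inj_same_image_perm => //; first exact: kidx_inj.
by rewrite /kidx enum_rankK image_ksub_idx.
Qed.

Lemma image_kidx_comp (p k : nat) (I : 'I_(#|{: ksub p k}|)) (s : 'S_k) :
  ((kidx I \o s) @: 'I_k)%SET = val (enum_val I).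
Proof.
rewrite -image_ksub_idx; apply/setP => x; apply/imsetP/imsetP => -[r _ ->].
  by exists (s r).
by exists (s^-1%g r); rewrite //= permKV.
Qed.

Section Alternating.
Variable R : numDomainType.

Lemma alternating_inj (a c : nat) (G : ('I_a -> 'I_c) -> R) (g : 'I_a -> 'I_c) :
  (forall (s : 'S_a) g, G (g \o s) = (-1) ^+ s * G g) ->
  ~ injective g -> G g = 0.
Proof.
move=> HG /injectiveP/injectivePn[x [y xy gxy]].
have gs : g \o tperm x y = g.
  by apply/funext => r /=; case: tpermP => // ->.
have := HG (tperm x y) g; rewrite gs odd_tperm xy expr1 mulN1r => /eqP.
by rewrite -addr_eq0 -mulr2n mulrn_eq0 /= => /eqP.
Qed.

(** Maps that are not injective contribute zero. An injective one is, in exactly one way, an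
    enumeration [kidx I] preceded by a permutation; summing the signs over the permutations produces
    the minor of [A]. *)
Lemma alternating_sum (a c : nat) (A : 'M[R]_(a, c)) (G : ('I_a -> 'I_c) -> R) :
  (forall (s : 'S_a) g, G (g \o s) = (-1) ^+ s * G g) ->
  \sum_(g : {ffun 'I_a -> 'I_c}) (\prod_r A r (g r)) * G g
  = \sum_I \det (colsub (kidx I) A) * G (kidx I).
Proof.
move=> HG.
pose h (p : 'I_(#|{: ksub c a}|) * 'S_a) := [ffun r => kidx p.1 (p.2 r)].
have hE p : h p = kidx p.1 \o p.2 :> (_ -> _) by apply/funext => r; rewrite ffunE.
have hi : injective h.
  move=> [I s] [J t] e.
  have E : kidx I \o s = kidx J \o t by rewrite -(hE (I, s)) -(hE (J, t)) e.
  have IJ : I = J.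
    apply/enum_val_inj/val_inj.
    by rewrite -(image_kidx_comp I s) -(image_kidx_comp J t) E.
  subst J; congr (_, _); apply/permP => r.
  by have /= := congr1 (@^~ r) E => /kidx_inj.
rewrite (bigID (mem (h @: [set: _])%SET)) /= [X in _ + X]big1 ?addr0; last first.
  move=> g gh; rewrite (alternating_inj HG) ?mulr0 // => gi.
  have [I [s E]] := ksub_of_inj gi.
  case/negP: gh; apply/imsetP; exists (I, s) => //.
  by apply/ffunP => r; rewrite ffunE E.
rewrite big_imset /=; last by move=> x y _ _; exact: hi.
rewrite (eq_bigl xpredT) => [|x]; last by rewrite inE.
rewrite -(pair_bigA _ (fun I s => \prod_r A r (h (I, s) r) * G (h (I, s)))) /=.
apply: eq_bigr => I _; rewrite /determinant mulr_suml; apply: eq_bigr => s _.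
rewrite (hE (I, s)) HG mulrCA mulrA; congr (_ * _ * _).
by apply: eq_bigr => r _; rewrite mxE.
Qed.

Lemma multilinear_mulmx (a c d : nat) (S : finType) (co : S -> R)
    (phi : S -> 'I_a -> 'I_d) (A : 'M[R]_(a, c)) (B : 'M[R]_(c, d)) :
  \sum_s co s * \prod_r (A *m B) r (phi s r)
  = \sum_(g : {ffun 'I_a -> 'I_c})
      (\prod_r A r (g r)) * \sum_s co s * \prod_r B (g r) (phi s r).
Proof.
under [RHS]eq_bigr do rewrite mulr_sumr.
rewrite exchange_big /=; apply: eq_bigr => s _.
under eq_bigr do rewrite mxE.
rewrite bigA_distr_bigA mulr_sumr; apply: eq_bigr => g _.
by rewrite big_split mulrCA.
Qed.

(* [co] and [phi] present [D] as a combination of products of one entry per row,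
   that is, as a multilinear function of the rows. *)
Lemma alternating_mulmx (a c d : nat) (S : finType) (co : S -> R)
    (phi : S -> 'I_a -> 'I_d) (D : 'M[R]_(a, d) -> R)
    (A : 'M[R]_(a, c)) (B : 'M[R]_(c, d)) :
  (forall X, D X = \sum_s co s * \prod_r X r (phi s r)) ->
  (forall s X, D (row_perm s X) = (-1) ^+ s * D X) ->
  D (A *m B) = \sum_I \det (colsub (kidx I) A) * D (rowsub (kidx I) B).
Proof.
move=> DE Dp; rewrite DE multilinear_mulmx.
rewrite -(alternating_sum _ (G := fun g => D (rowsub g B))); last first.
  move=> s g; rewrite -Dp; congr D; apply/matrixP => i j.
  by rewrite !mxE.
apply: eq_bigr => g _; rewrite DE; congr (_ * _); apply: eq_bigr => s _.
by congr (_ * _); apply: eq_bigr => r _; rewrite mxE.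
Qed.

Lemma Cauchy_Binet (k N : nat) (A : 'M[R]_(k, N)) (B : 'M[R]_(N, k)) :
  \det (A *m B) = \sum_I \det (colsub (kidx I) A) * \det (rowsub (kidx I) B).
Proof.
apply: (alternating_mulmx (S := 'S_k) (co := fun s => (-1) ^+ s)
         (phi := fun s r => s r)) => [X|s X] //.
by rewrite row_permE det_mulmx det_perm.
Qed.

(** With [Y] fixed, the determinant is multilinear and alternating in the top rows: in the Leibniz
    formula the entries of [Y] are absorbed into the coefficients. This is Cauchy-Binet for one
    block of rows at a time. *)
Lemma det_col_mx_mul_up (a b c : nat) (A : 'M[R]_(a, c)) (X : 'M[R]_(c, a + b))
    (Y : 'M[R]_(b, a + b)) :
  \det (col_mx (A *m X) Y)
  = \sum_I \det (colsub (kidx I) A) * \det (col_mx (rowsub (kidx I) X) Y).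
Proof.
apply: (alternating_mulmx (S := 'S_(a + b))
    (co := fun s => (-1) ^+ s * \prod_(r < b) Y r (s (rshift a r)))
    (phi := fun s r => s (lshift b r)) (D := fun X => \det (col_mx X Y))) => [Z|s Z].
  apply: eq_bigr => s _; rewrite -mulrA; congr (_ * _).
  rewrite big_split_ord /= mulrC; congr (_ * _); apply: eq_bigr => r _ /=.
    by rewrite col_mxEd.
  by rewrite col_mxEu.
have -> : col_mx (row_perm s Z) Y = block_mx (perm_mx s) 0 0 1%:M *m col_mx Z Y.
  by rewrite mul_block_col !mul0mx addr0 add0r mul1mx row_permE.
by rewrite det_mulmx det_ublock det1 mulr1 det_perm.
Qed.

Lemma det_col_mx_mul_down (a b c : nat) (A : 'M[R]_(b, c)) (X : 'M[R]_(c, a + b))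
    (Y : 'M[R]_(a, a + b)) :
  \det (col_mx Y (A *m X))
  = \sum_I \det (colsub (kidx I) A) * \det (col_mx Y (rowsub (kidx I) X)).
Proof.
apply: (alternating_mulmx (S := 'S_(a + b))
    (co := fun s => (-1) ^+ s * \prod_(r < a) Y r (s (lshift b r)))
    (phi := fun s r => s (rshift a r)) (D := fun X => \det (col_mx Y X))) => [Z|s Z].
  apply: eq_bigr => s _; rewrite -mulrA; congr (_ * _).
  rewrite big_split_ord /=; congr (_ * _); apply: eq_bigr => r _ /=.
    by rewrite col_mxEu.
  by rewrite col_mxEd.
have -> : col_mx Y (row_perm s Z) = block_mx 1%:M 0 0 (perm_mx s) *m col_mx Y Z.
  by rewrite mul_block_col !mul0mx addr0 add0r mul1mx row_permE.
by rewrite det_mulmx det_ublock det1 mul1r det_perm.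
Qed.

(** The equation is a parameter because in the application [k - i + i] and [k] are equal but not
    convertible. *)
Definition join_idx (n m a b k : nat) (e : (a + b)%N = k) (f1 : 'I_a -> 'I_n)
    (f2 : 'I_b -> 'I_m) : 'I_k -> 'I_(n + m) := fun r =>
  match fintype.split (cast_ord (esym e) r) with
  | inl x => lshift m (f1 x)
  | inr x => rshift n (f2 x)
  end.

Lemma det_block_diag_join (n m a b k : nat) (e : (a + b)%N = k)
    (f1 : 'I_a -> 'I_n) (f2 : 'I_b -> 'I_m)
    (A : 'M[R]_n) (B : 'M[R]_m) (X : 'M[R]_(n + m, k)) :
  \det (rowsub (join_idx e f1 f2) (block_mx A 0 0 B *m X))
  = \sum_I \sum_J \det (mxsub f1 (kidx I) A) * \det (mxsub f2 (kidx J) B)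
                  * \det (rowsub (join_idx e (kidx I) (kidx J)) X).
Proof.
case: _ / e X => X.
have jE g1 g2 (Z : 'M[R]_(n + m, a + b)) : rowsub (join_idx erefl g1 g2) Z
    = col_mx (rowsub g1 (usubmx Z)) (rowsub g2 (dsubmx Z)).
  apply/matrixP => i j; rewrite !mxE /join_idx cast_ord_id.
  by case: fintype.split => x; rewrite !mxE.
rewrite jE -[X]vsubmxK mul_block_col !mul0mx addr0 add0r col_mxKu col_mxKd.
have -> : rowsub f1 (A *m usubmx X) = rowsub f1 A *m usubmx X.
  by apply/matrixP => i j; rewrite !mxE; apply: eq_bigr => r _; rewrite !mxE.
have -> : rowsub f2 (B *m dsubmx X) = rowsub f2 B *m dsubmx X.
  by apply/matrixP => i j; rewrite !mxE; apply: eq_bigr => r _; rewrite !mxE.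
rewrite det_col_mx_mul_up; apply: eq_bigr => I _.
rewrite det_col_mx_mul_down mulr_sumr; apply: eq_bigr => J _.
rewrite mulrA jE col_mxKu col_mxKd.
have -> : colsub (kidx I) (rowsub f1 A) = mxsub f1 (kidx I) A.
  by apply/matrixP => i j; rewrite !mxE.
have -> // : colsub (kidx J) (rowsub f2 B) = mxsub f2 (kidx J) B.
by apply/matrixP => i j; rewrite !mxE.
Qed.

End Alternating.

(** The permutation spares any comparison of the orders in which the two sides list the same set. It
    costs only a sign, which absolute values remove. *)
Lemma split_ksub (n m k : nat) (K : 'I_(#|{: ksub (n + m) k}|)) :
  exists i : 'I_k.+1, exists I : 'I_(#|{: ksub n (k - i)}|),
  exists J : 'I_(#|{: ksub m i}|), exists s : 'S_k,
  kidx K = join_idx (subnK (leq_ord i)) (kidx I) (kidx J) \o s.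
Proof.
set S := val (enum_val K); have Sk : #|S| = k by apply/eqP; exact: (valP (enum_val K)).
pose S1 := [set x | lshift m x \in S]%SET.
pose S2 := [set x | rshift n x \in S]%SET.
have li : injective (@lshift n m) by exact: lshift_inj.
have ri : injective (@rshift n m) by exact: rshift_inj.
have S12 : (S = (@lshift n m @: S1) :|: (@rshift n m @: S2))%SET.
  apply/setP => x; rewrite finset.in_setU; apply/idP/orP.
    case: (split_ordP x) => y -> yS; [left|right]; apply/imsetP; exists y => //;
    by rewrite inE.
  by case=> /imsetP[y yS ->]; move: yS; rewrite inE.
have dis : ((@lshift n m @: S1) :&: (@rshift n m @: S2))%SET = finset.set0.
  apply/setP => x; rewrite !inE; apply/negP => /andP[].
  by case/imsetP => y _ ->; case/imsetP => z _ /eqP; rewrite eq_lrshift.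
have cS : (#|S1| + #|S2| = k)%N.
  by rewrite -Sk S12 cardsU dis cards0 subn0 !card_imset.
have ik : (#|S2| < k.+1)%N by rewrite ltnS -cS leq_addl.
have S1k : #|S1| == (k - Ordinal ik)%N by rewrite /= -cS addnK.
have S2k : #|S2| == Ordinal ik by [].
exists (Ordinal ik), (enum_rank (Ksub S1k)),
  (enum_rank (Ksub S2k)).
set e := subnK _; move: e; rewrite /= => e.
set I := enum_rank _; set J := enum_rank _.
have HI r : kidx I r \in S1 := mem_kidx_rank (Ksub S1k) r.
have HJ r : kidx J r \in S2 := mem_kidx_rank (Ksub S2k) r.
have ji : injective (join_idx e (kidx I) (kidx J)).
  move=> x y; rewrite /join_idx.
  case E1: (fintype.split _) => [u|u]; case E2: (fintype.split _) => [v|v].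
  - move=> /li/kidx_inj uv; apply: (@cast_ord_inj _ _ (esym e)).
    by apply: (can_inj (@splitK _ _)); rewrite E1 E2 uv.
  - by move=> /eqP; rewrite eq_lrshift.
  - by move=> /eqP; rewrite eq_rlshift.
  - move=> /ri/kidx_inj uv; apply: (@cast_ord_inj _ _ (esym e)).
    by apply: (can_inj (@splitK _ _)); rewrite E1 E2 uv.
apply: inj_same_image_perm => //; first exact: kidx_inj.
rewrite [LHS]image_ksub_idx -/S; apply/esym/eqP; rewrite eqEcard.
rewrite card_imset // card_ord Sk leqnn andbT.
apply/fintype.subsetP => x /imsetP[r _ ->]; rewrite /join_idx.
by case: fintype.split => u; [have := HI u|have := HJ u]; rewrite inE.
Qed.

(** * Finite-dimensional Lp norms *)

Section LpNorm.
Variable R : realType.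

(* [lpnorm] over an arbitrary finite index type, so that matrices are vectors. *)
Definition lpf (p : \bar R) (I : finType) (x : I -> R) : R :=
  match p with
  | r%:E => (\sum_i `|x i| `^ r) `^ r^-1
  | +oo%E => \big[Num.max/0]_i `|x i|
  | -oo%E => 0
  end.

Lemma lpnormE (p : \bar R) (d : nat) (x : 'cV[R]_d) :
  lpnorm p x = lpf p (fun i => x i 0).
Proof. by []. Qed.

Lemma lpf_powR (r : R) (I : finType) (x : I -> R) : 1 <= r ->
  lpf r%:E x `^ r = \sum_i `|x i| `^ r.
Proof.
move=> r1; rewrite /lpf -powRrM mulVf ?powRr1 ?gt_eqF ?(lt_le_trans _ r1)//.
by apply: sumr_ge0 => i _; exact: powR_ge0.
Qed.

Lemma lpf_ge0 p (I : finType) (x : I -> R) : 0 <= lpf p x.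
Proof.
case: p => [r||] //=; first exact: powR_ge0.
by apply: (big_ind (fun u => 0 <= u)) => // a b a0 b0; rewrite le_max a0.
Qed.

Lemma lpf_le_powR (r : R) (I : finType) (x : I -> R) c : 1 <= r -> 0 <= c ->
  (lpf r%:E x <= c) = (\sum_i `|x i| `^ r <= c `^ r).
Proof.
move=> r1 c0; rewrite -lpf_powR //.
have r0 : 0 < r by rewrite (lt_le_trans _ r1).
apply/idP/idP => h.
  by apply: ge0_ler_powR; rewrite ?nnegrE ?lpf_ge0 // ltW.
rewrite leNgt; apply/negP => /(gt0_ltr_powR r0).
by rewrite !nnegrE lpf_ge0 c0 ltNge h => /(_ isT isT).
Qed.

Lemma lpf_le_max (I : finType) (x : I -> R) c : 0 <= c ->
  (lpf +oo x <= c) <-> (forall i, `|x i| <= c).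
Proof.
move=> c0; split => [h i|h]; last by apply: bigmax_le => // i _; exact: h.
by apply: le_trans h; exact: (le_bigmax _ (fun i => `|x i|)).
Qed.

Lemma ge1_ereal_ind (P : \bar R -> Prop) : (forall r, 1 <= r -> P r%:E) -> P +oo%E ->
  forall p, (1%:E <= p)%E -> P p.
Proof. by move=> Pr Poo [r|//|//]; rewrite lee_fin; exact: Pr. Qed.

Section Basic.
Variables (p : \bar R) (p1 : (1%:E <= p)%E).

Lemma le_lpf (I : finType) (x : I -> R) i : `|x i| <= lpf p x.
Proof.
move: p p1; apply: ge1_ereal_ind => [r r1|]; last exact: (le_bigmax _ (fun i => `|x i|)).
rewrite leNgt; apply/negP => h; have r0 : 0 < r by rewrite (lt_le_trans _ r1).
have := gt0_ltr_powR r0 _ _ h.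
rewrite !nnegrE lpf_ge0 normr_ge0 lpf_powR // (bigD1 i) //= => /(_ isT isT).
by rewrite gtrDl ltNge sumr_ge0 // => j _; exact: powR_ge0.
Qed.

Lemma lpf_mono (I : finType) (x y : I -> R) :
  (forall i, `|x i| <= `|y i|) -> lpf p x <= lpf p y.
Proof.
move=> h; move: p p1; apply: ge1_ereal_ind => [r r1|]; last first.
  apply/lpf_le_max => [|i]; first exact: lpf_ge0.
  by apply: le_trans (h i) _; exact: (le_bigmax _ (fun i => `|y i|)).
rewrite lpf_le_powR ?lpf_ge0 // lpf_powR //; apply: ler_sum => i _.
by apply: ge0_ler_powR; rewrite ?nnegrE // ltW // (lt_le_trans _ r1).
Qed.

Lemma lpfZ (I : finType) (a : R) (x : I -> R) :
  lpf p (fun i => a * x i) = `|a| * lpf p x.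
Proof.
(* Used for [a] and then for its inverse, this one inequality gives the equality. *)
have H b (y : I -> R) : lpf p (fun i => b * y i) <= `|b| * lpf p y.
  move: p p1; apply: ge1_ereal_ind => [r r1|]; last first.
    apply/lpf_le_max => [|i]; first by rewrite mulr_ge0 ?lpf_ge0.
    by rewrite normrM ler_wpM2l //; exact: (le_bigmax _ (fun i => `|y i|)).
  rewrite lpf_le_powR ?mulr_ge0 ?lpf_ge0 // powRM ?lpf_ge0 // lpf_powR // mulr_sumr.
  by apply: ler_sum => i _; rewrite normrM powRM.
apply/eqP; rewrite eq_le H /=; have [->|a0] := eqVneq a 0.
  by rewrite normr0 mul0r lpf_ge0.
rewrite -ler_pdivlMl ?normr_gt0 // -normfV; apply: le_trans (H _ _).
by apply: lpf_mono => i; rewrite mulKf.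
Qed.

(** Minkowski's inequality. With [A] and [B] the two norms, [(|x i| + |y i|) / (A + B)] is the
    convex combination of [|x i| / A] and [|y i| / B] with weights [A / (A + B)] and [B / (A + B)];
    convexity of the power is applied to it and the result summed over [i]. Vanishing norms are
    treated apart because of the divisions. *)
Lemma lpfD (I : finType) (x y : I -> R) :
  lpf p (fun i => x i + y i) <= lpf p x + lpf p y.
Proof.
have [A0|A0] := eqVneq (lpf p x) 0.
  rewrite A0 add0r; apply: lpf_mono => i.
  suff -> : x i = 0 by rewrite add0r.
  by apply/eqP; rewrite -normr_eq0 eq_le normr_ge0 andbT -A0 le_lpf.
have [B0|B0] := eqVneq (lpf p y) 0.
  rewrite B0 addr0; apply: lpf_mono => i.
  suff -> : y i = 0 by rewrite addr0.
  by apply/eqP; rewrite -normr_eq0 eq_le normr_ge0 andbT -B0 le_lpf.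
have Ap : 0 < lpf p x by rewrite lt_def A0 lpf_ge0.
have Bp : 0 < lpf p y by rewrite lt_def B0 lpf_ge0.
move: p p1 A0 B0 Ap Bp; apply: ge1_ereal_ind => [r r1|] _ _; last first.
  move=> _ _; apply/lpf_le_max => [|i]; first by rewrite addr_ge0 ?lpf_ge0.
  apply: le_trans (ler_normD _ _) _; apply: lerD.
    exact: (le_bigmax _ (fun i => `|x i|)).
  exact: (le_bigmax _ (fun i => `|y i|)).
have := lpf_powR x r1; have := lpf_powR y r1; move: (lpf _ x) (lpf _ y) => A B EB EA Ap Bp.
have r0 : 0 <= r by rewrite (le_trans _ r1).
have ABp : 0 < A + B by rewrite addr_gt0.
rewrite (lpf_le_powR _ r1 (ltW ABp)).
pose t := A / (A + B).
have t0 : 0 <= t by rewrite divr_ge0 // ltW.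
have t1 : t <= 1 by rewrite ler_pdivrMr // mul1r lerDl ltW.
have t1' : 1 - t = B / (A + B) by rewrite /t; field; rewrite gt_eqF.
have pd (u C : R) : 0 < C -> `|u| `^ r / C `^ r = (`|u| / C) `^ r.
  move=> C0; have Cr : C `^ r != 0 by rewrite gt_eqF ?powR_gt0.
  apply: (mulIf Cr); rewrite divfK // -powRM ?divfK ?gt_eqF ?(ltW C0) //.
  by rewrite divr_ge0 // ltW.
have key i : `|x i + y i| `^ r <=
    (A + B) `^ r * (t * (`|x i| `^ r / A `^ r) + (1 - t) * (`|y i| `^ r / B `^ r)).
  have -> : `|x i| `^ r / A `^ r = (`|x i| / A) `^ r.
    exact: pd.
  have -> : `|y i| `^ r / B `^ r = (`|y i| / B) `^ r.
    exact: pd.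
  have nn (u C : R) : 0 < C -> `|u| / C \in (`[0%R, +oo[%classic : set R).
    by move=> C0; rewrite inE /= in_itv /= andbT divr_ge0 // ltW.
  have := convex_powR r1 (Itv01 t0 t1) (nn (x i) _ Ap) (nn (y i) _ Bp).
  rewrite !convRE /= => cv.
  have P0 : 0 <= (A + B) `^ r by rewrite powR_ge0.
  apply: le_trans (ler_wpM2l P0 cv).
  have q0 : 0 <= t * (`|x i| / A) + (1 - t) * (`|y i| / B).
    by rewrite addr_ge0 // mulr_ge0 ?divr_ge0 ?subr_ge0 // ltW.
  rewrite -powRM ?(ltW ABp) //; apply: ge0_ler_powR; rewrite ?nnegrE ?mulr_ge0 ?(ltW ABp) //.
  have -> : (A + B) * (t * (`|x i| / A) + (1 - t) * (`|y i| / B)) = `|x i| + `|y i|.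
    by rewrite t1' /t; field; rewrite !gt_eqF.
  exact: ler_normD.
apply: le_trans (ler_sum _ (fun i _ => key i)) _.
rewrite -mulr_sumr big_split /= -!mulr_sumr -!mulr_suml -EA -EB.
by rewrite !divff ?gt_eqF ?powR_gt0 // !mulr1 subrKC mulr1.
Qed.

Lemma lpf_le_sum (I : finType) (x : I -> R) : lpf p x <= \sum_i `|x i|.
Proof.
have s0 : 0 <= \sum_i `|x i| by apply: sumr_ge0.
have le_s i : `|x i| <= \sum_i `|x i| by rewrite (bigD1 i) //= lerDl sumr_ge0.
move: p p1; apply: ge1_ereal_ind => [r r1|]; last by apply/lpf_le_max.
have r0 : 0 < r by rewrite (lt_le_trans _ r1).
(* With [s] the sum, [|x i|^r] is at most [|x i| * s^(r-1)], and these bounds add up to [s^r]. *)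
rewrite lpf_le_powR // -mulr_powRB1 // mulr_suml; apply: ler_sum => i _.
rewrite -mulr_powRB1 // ler_wpM2l //; apply: ge0_ler_powR; rewrite ?nnegrE //.
by rewrite subr_ge0.
Qed.

(** Together with [lpf_swap], this turns the entrywise norm of a matrix into an iterated norm, by
    rows or by columns, so that a product can be estimated one column at a time. *)
Lemma lpf_pair (I J : finType) (W : I -> J -> R) :
  lpf p (fun ij : I * J => W ij.1 ij.2) = lpf p (fun i => lpf p (W i)).
Proof.
move: p p1; apply: ge1_ereal_ind => [r r1|].
  apply: (congr1 (fun u => u `^ r^-1)).
  rewrite -(pair_bigA _ (fun i j => `|W i j| `^ r)); apply: eq_bigr => i _.
  by rewrite (ger0_norm (lpf_ge0 r%:E (W i))) lpf_powR.
apply/eqP; rewrite eq_le; apply/andP; split.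
  apply/lpf_le_max => [|[i j]]; first exact: lpf_ge0.
  apply: le_trans (le_bigmax _ (fun i => `|lpf +oo (W i)|) i).
  rewrite (ger0_norm (lpf_ge0 +oo (W i))); exact: (le_bigmax _ (fun j => `|W i j|) j).
apply/lpf_le_max => [|i]; first exact: lpf_ge0.
rewrite ger0_norm ?lpf_ge0 //; apply/lpf_le_max => [|j]; first exact: lpf_ge0.
exact: (le_bigmax _ (fun ij : I * J => `|W ij.1 ij.2|) (i, j)).
Qed.

Lemma lpf_swap (I J : finType) (W : I -> J -> R) :
  lpf p (fun ij : I * J => W ij.1 ij.2) = lpf p (fun ji : J * I => W ji.2 ji.1).
Proof.
move: p p1; apply: ge1_ereal_ind => [r r1|].
  rewrite /lpf -(pair_bigA _ (fun i j => `|W i j| `^ r)) exchange_big /=.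
  by rewrite (pair_bigA _ (fun j i => `|W i j| `^ r)).
apply/eqP; rewrite eq_le; apply/andP; split;
  apply/lpf_le_max => [|[i j]]; rewrite ?lpf_ge0 //=.
  exact: (le_bigmax _ (fun ji : J * I => `|W ji.2 ji.1|) (j, i)).
exact: (le_bigmax _ (fun ij : I * J => `|W ij.1 ij.2|) (j, i)).
Qed.

Lemma lpnorm_is_norm (d : nat) : is_norm (@lpnorm R p d).
Proof.
split=> [x|x x0|a x|x y].
- exact: lpf_ge0.
- apply/matrixP => i j; rewrite ord1 mxE; apply/eqP; rewrite -normr_eq0.
  rewrite eq_le normr_ge0 andbT -x0 lpnormE; exact: (le_lpf (fun i => x i 0)).
- rewrite !lpnormE -lpfZ; congr (lpf _ _); apply/funext => i; by rewrite mxE.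
- rewrite !lpnormE; apply: le_trans (lpfD _ _).
  by apply: lpf_mono => i; rewrite mxE.
Qed.

Lemma le_lpnorm (d : nat) (x : 'cV[R]_d) i : `|x i 0| <= lpnorm p x.
Proof. exact: (le_lpf (fun i => x i 0)). Qed.

End Basic.
End LpNorm.

(** * Induced norms and matrix measures *)

Section InducedNorm.
Variables (R : realType) (d : nat) (nu : 'cV[R]_d -> R).
Hypothesis nu_norm : is_norm nu.
Hypothesis nu_lo : forall (x : 'cV[R]_d) i, `|x i 0| <= nu x.
Hypothesis nu_hi : forall x : 'cV[R]_d, nu x <= \sum_i `|x i 0|.

(** Comparing [nu] with the coordinates from both sides gives the finiteness that the supremum in
    [indnorm] needs. *)
Lemma norm_mulmx_le_sum (A : 'M[R]_d) x :
  nu (A *m x) <= (\sum_i \sum_j `|A i j|) * nu x.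
Proof.
apply: le_trans (nu_hi _) _; rewrite mulr_suml; apply: ler_sum => i _.
rewrite mxE; apply: le_trans (ler_norm_sum _ _ _) _; rewrite mulr_suml.
by apply: ler_sum => j _; rewrite normrM ler_wpM2l.
Qed.

Lemma indnorm_has_ubound (A : 'M[R]_d) :
  has_ubound [set nu (A *m x) | x in [set x | nu x = 1]].
Proof.
exists (\sum_i \sum_j `|A i j|) => _ [x /= x1 <-].
by have := norm_mulmx_le_sum A x; rewrite x1 mulr1.
Qed.

Lemma indnorm_ge0 (A : 'M[R]_d) : 0 <= indnorm nu A.
Proof.
case: nu_norm => n0 _ _ _; rewrite /indnorm; set S := [set _ | _ in _].
(* In dimension zero there is no unit vector, and the supremum of the empty set is 0 by default.
   Compounds of too high an order have this dimension. *)
have [->|/set0P[y Sy]] := eqVneq S set0; first by rewrite sup0.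
apply: le_trans (ub_le_sup (indnorm_has_ubound A) Sy).
by case: Sy => x _ <-; exact: n0.
Qed.

Lemma le_indnorm (A : 'M[R]_d) x : nu (A *m x) <= indnorm nu A * nu x.
Proof.
case: nu_norm => n0 nz nZ _; have [/nz ->|x0] := eqVneq (nu x) 0.
  have n00 : nu 0 = 0 by rewrite -(scale0r 0) nZ normr0 mul0r.
  by rewrite mulmx0 n00 mulr0.
have xp : 0 < nu x by rewrite lt_def x0 n0.
rewrite -ler_pdivrMr //; apply: ub_le_sup; first exact: indnorm_has_ubound.
exists ((nu x)^-1 *: x) => /=.
  by rewrite nZ ger0_norm ?invr_ge0 ?n0 // mulVf.
by rewrite -scalemxAr nZ ger0_norm ?invr_ge0 ?n0 // mulrC.
Qed.

Lemma indnorm_le (A : 'M[R]_d) c : 0 <= c ->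
  (forall x, nu (A *m x) <= c * nu x) -> indnorm nu A <= c.
Proof.
move=> c0 h; rewrite /indnorm; set S := [set _ | _ in _].
have [->|/set0P S0] := eqVneq S set0; first by rewrite sup0.
by apply: ge_sup => // _ [x /= x1 <-]; have := h x; rewrite x1 mulr1.
Qed.

Lemma indnormD (A B : 'M[R]_d) : indnorm nu (A + B) <= indnorm nu A + indnorm nu B.
Proof.
case: nu_norm => _ _ _ nD; apply: indnorm_le => [|x].
  by rewrite addr_ge0 ?indnorm_ge0.
by rewrite mulmxDl mulrDl; apply: le_trans (nD _ _) _; rewrite lerD ?le_indnorm.
Qed.

Lemma indnormZ (a : R) (A : 'M[R]_d) : indnorm nu (a *: A) <= `|a| * indnorm nu A.
Proof.
case: nu_norm => _ _ nZ _; apply: indnorm_le => [|x].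
  by rewrite mulr_ge0 ?indnorm_ge0.
by rewrite -scalemxAl nZ -mulrA ler_wpM2l ?le_indnorm.
Qed.

Lemma indnorm_le_sum (A : 'M[R]_d) : indnorm nu A <= \sum_i \sum_j `|A i j|.
Proof.
apply: indnorm_le => [|x]; last exact: norm_mulmx_le_sum.
by apply: sumr_ge0 => i _; apply: sumr_ge0.
Qed.

Lemma indnorm1 : (0 < d)%N -> indnorm nu 1%:M = 1.
Proof.
case: nu_norm => n0 nz nZ _ d0; apply/eqP; rewrite eq_le; apply/andP; split.
  by apply: indnorm_le => // x; rewrite mul1mx mul1r.
pose i : 'I_d := Ordinal d0; pose x : 'cV[R]_d := delta_mx i 0.
have xp : 0 < nu x.
  by apply: lt_le_trans (nu_lo x i); rewrite mxE !eqxx normr1.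
by rewrite -(ler_pM2r xp) mul1r -{1}(mul1mx x) le_indnorm.
Qed.

Hypothesis d0 : (0 < d)%N.

Let quot (A : 'M[R]_d) (e : R) : R := (indnorm nu (1%:M + e *: A) - 1) / e.

(** [lim] is informative only once convergence is known. The quotient is nondecreasing in [e], since
    for [0 < x <= y] the matrix [1 + x A] is the convex combination of [1] and [1 + y A] with weight
    [x / y] on the latter; it is bounded below by minus the norm of [A]. *)
Lemma mxmeasure_cvg (A : 'M[R]_d) :
  (fun e : R => (indnorm nu (1%:M + e *: A) - 1) / e) @ 0^'+ --> mxmeasure nu A.
Proof.
have mono : {in Interval (BRight 0) (BLeft 1) &,
    {homo quot A : x y / x <= y}}.
  move=> x y; rewrite !in_itv /= => /andP[x0 _] /andP[y0 _] xy.
  rewrite /quot ler_pdivrMr // mulrAC ler_pdivlMr //.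
  have E : y *: (1%:M + x *: A) = (y - x) *: 1%:M + x *: (1%:M + y *: A).
    by rewrite !scalerDr addrA -scalerDl subrK !scalerA mulrC.
  have : indnorm nu (y *: (1%:M + x *: A))
      <= (y - x) + x * indnorm nu (1%:M + y *: A).
    rewrite E; apply: le_trans (indnormD _ _) _; apply: lerD.
      apply: le_trans (indnormZ _ _) _.
      by rewrite indnorm1 // mulr1 ger0_norm // subr_ge0.
    by apply: le_trans (indnormZ _ _) _; rewrite gtr0_norm.
  have : indnorm nu (1%:M + x *: A) <= y^-1 * indnorm nu (y *: (1%:M + x *: A)).
    rewrite -{1}[1%:M + x *: A](scale1r) -(mulVf (lt0r_neq0 y0)) -scalerA.
    by apply: le_trans (indnormZ _ _) _; rewrite gtr0_norm ?invr_gt0.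
  rewrite ler_pdivlMl // => h1 h2; have := le_trans h1 h2.
  lra.
have lb : has_lbound [set quot A e | e in [set` Interval (BRight 0) (BLeft 1)]].
  exists (- indnorm nu A) => _ [e /= + <-]; rewrite in_itv /= => /andP[e0 _].
  rewrite /quot ler_pdivlMr //.
  have : indnorm nu ((1%:M + e *: A) + (- e) *: A)
      <= indnorm nu (1%:M + e *: A) + e * indnorm nu A.
    apply: le_trans (indnormD _ _) _; rewrite lerD2l.
    by apply: le_trans (indnormZ _ _) _; rewrite normrN gtr0_norm.
  by rewrite scaleNr addrK indnorm1 //; lra.
have := nondecreasing_at_right_cvgr _ mono lb.
rewrite bnd_simp ltr01 => /(_ isT) h.
by apply: cvgP h.
Qed.

Lemma near_indnorm_le (A : 'M[R]_d) (c : R) : mxmeasure nu A < c ->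
  \forall h \near 0^'+, indnorm nu (1%:M + h *: A) <= 1 + h * c.
Proof.
move=> mc; have H := cvgr_le _ (@mxmeasure_cvg A) _ mc.
near=> h.
have h0 : 0 < h by near: h; exact: nbhs_right_gt.
have : (indnorm nu (1%:M + h *: A) - 1) / h <= c.
  by near: h; exact: H.
by rewrite ler_pdivrMr //; lra.
Unshelve. all: by end_near. Qed.

End InducedNorm.

(** * Entrywise Lp norms of matrices *)

Section MatrixLp.
Variables (R : realType) (p : \bar R) (p1 : (1%:E <= p)%E).

Definition mxlp (a b : nat) (W : 'M[R]_(a, b)) : R :=
  lpf p (fun ij : 'I_a * 'I_b => W ij.1 ij.2).

Lemma lpnorm_le_sum (d : nat) (x : 'cV[R]_d) : lpnorm p x <= \sum_i `|x i 0|.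
Proof. exact: (lpf_le_sum p1 (fun i => x i 0)). Qed.

Lemma indnorm_lp_ge0 (a : nat) (A : 'M[R]_a) : 0 <= indnorm (@lpnorm R p a) A.
Proof.
exact: (indnorm_ge0 (lpnorm_is_norm p1 a) (@le_lpnorm _ _ p1 a) (@lpnorm_le_sum a)).
Qed.

Lemma lpf_mulmx (a : nat) (A : 'M[R]_a) (x : 'cV[R]_a) :
  lpf p (fun i => (A *m x) i 0) <= indnorm (@lpnorm R p a) A * lpf p (fun i => x i 0).
Proof.
exact: (le_indnorm (lpnorm_is_norm p1 a) (@le_lpnorm _ _ p1 a) (@lpnorm_le_sum a)).
Qed.

Lemma lpf_indnormZ (a : nat) (I : finType) (A : 'M[R]_a) (x : I -> R) :
  lpf p (fun i => indnorm (@lpnorm R p a) A * x i)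
  = indnorm (@lpnorm R p a) A * lpf p x.
Proof.
rewrite lpfZ // ger0_norm //.
exact: indnorm_lp_ge0.
Qed.

(** [A] acts on each column of [W] with factor at most its induced norm, and the entrywise norm is
    the [L_p] norm of the column norms. *)
Lemma mxlp_mulmxl (a b : nat) (A : 'M[R]_a) (W : 'M[R]_(a, b)) :
  mxlp (A *m W) <= indnorm (@lpnorm R p a) A * mxlp W.
Proof.
have E (X : 'M[R]_(a, b)) : mxlp X = lpf p (fun j => lpf p (fun i => X i j)).
  by rewrite /mxlp (lpf_swap p1 (fun i j => X i j)) (lpf_pair p1 (fun j i => X i j)).
rewrite !E -lpf_indnormZ; apply: (lpf_mono p1) => j.
rewrite !ger0_norm ?lpf_ge0 ?mulr_ge0 ?lpf_ge0 //; last first.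
  exact: indnorm_lp_ge0.
have := lpf_mulmx A (col j W).
have -> : (fun i => (A *m col j W) i 0) = (fun i => (A *m W) i j).
  by apply/funext => i; rewrite !mxE; apply: eq_bigr => r _; rewrite mxE.
by have -> : (fun i => col j W i 0) = (fun i => W i j) by apply/funext => i; rewrite mxE.
Qed.

Lemma mxlp_tr (a b : nat) (W : 'M[R]_(a, b)) : mxlp W^T = mxlp W.
Proof.
rewrite /mxlp (lpf_swap p1 (fun i j => W^T i j)).
by congr (lpf _ _); apply/funext => i; rewrite mxE.
Qed.

Lemma mxlp_mulmxr (a b : nat) (B : 'M[R]_b) (W : 'M[R]_(a, b)) :
  mxlp (W *m B^T) <= indnorm (@lpnorm R p b) B * mxlp W.
Proof. by rewrite -mxlp_tr trmx_mul trmxK -(mxlp_tr W) mxlp_mulmxl. Qed.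

Lemma mxlp_le_sum (a b : nat) (W : 'M[R]_(a, b)) :
  mxlp W <= \sum_i \sum_j `|W i j|.
Proof.
apply: le_trans (lpf_le_sum p1 _) _.
by rewrite -(pair_bigA _ (fun i j => `|W i j|)).
Qed.

Lemma le_mxlp (a b : nat) (W : 'M[R]_(a, b)) i j : `|W i j| <= mxlp W.
Proof. exact: (le_lpf p1 (fun ij : 'I_a * 'I_b => W ij.1 ij.2) (i, j)). Qed.

Lemma mxlp_ge0 (a b : nat) (W : 'M[R]_(a, b)) : 0 <= mxlp W.
Proof. exact: lpf_ge0. Qed.

Lemma mxlpD (a b : nat) (V W : 'M[R]_(a, b)) : mxlp (V + W) <= mxlp V + mxlp W.
Proof.
apply: le_trans (lpfD p1 _ _).
by apply: lpf_mono => // ij; rewrite mxE.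
Qed.

Lemma mxlpZ (a b : nat) (c : R) (W : 'M[R]_(a, b)) : mxlp (c *: W) = `|c| * mxlp W.
Proof. by rewrite -lpfZ //; congr (lpf _ _); apply/funext => ij; rewrite mxE. Qed.

End MatrixLp.

(** * Tangency of curves *)

Section Tangent.
Variable R : realType.
Implicit Types (f g : R -> R) (t : R).

(** First-order contact with the common derivative left existential. It passes through sums and
    products, hence through minors, without any formula for the derivative of a determinant. *)
Definition tangent f g t := exists d : R,
  [/\ is_derive t (1 : R) f d, is_derive t (1 : R) g d & f t = g t].

Lemma tangent_refl f t (d : R) : is_derive t (1 : R) f d -> tangent f f t.
Proof. by exists d. Qed.

Lemma tangent_cst (c : R) t : tangent (fun _ => c) (fun _ => c) t.
Proof. by apply: (@tangent_refl _ _ 0); exact: is_derive_cst. Qed.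

Lemma tangent_trans f g h t : tangent f g t -> tangent g h t -> tangent f h t.
Proof.
move=> [d [fd gd fg]] [e [ge he gh]]; exists d; split=> //; last by rewrite fg.
by have <- : e = d by rewrite -(@derive_val _ _ _ _ _ _ _ gd) (@derive_val _ _ _ _ _ _ _ ge).
Qed.

Lemma tangentD f1 g1 f2 g2 t : tangent f1 g1 t -> tangent f2 g2 t ->
  tangent (fun s => f1 s + f2 s) (fun s => g1 s + g2 s) t.
Proof.
move=> [d [fd gd fg]] [e [fe ge fge]]; exists (d + e); split.
- exact: is_deriveD.
- exact: is_deriveD.
- by rewrite fg fge.
Qed.

Lemma tangentM f1 g1 f2 g2 t : tangent f1 g1 t -> tangent f2 g2 t ->
  tangent (fun s => f1 s * f2 s) (fun s => g1 s * g2 s) t.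
Proof.
move=> [d [fd gd fg]] [e [fe ge fge]]; exists (f1 t * e + f2 t * d); split.
- exact: is_deriveM.
- by rewrite fg fge; exact: is_deriveM.
- by rewrite fg fge.
Qed.

Lemma tangent_sum (I : Type) (r : seq I) (F G : I -> R -> R) t :
  (forall i, tangent (F i) (G i) t) ->
  tangent (fun s => \sum_(i <- r) F i s) (fun s => \sum_(i <- r) G i s) t.
Proof.
move=> FG; elim: r => [|a r IH].
  by under eq_fun do rewrite big_nil; under [X in tangent _ X _]eq_fun do rewrite big_nil;
     exact: tangent_cst.
under eq_fun do rewrite big_cons; under [X in tangent _ X _]eq_fun do rewrite big_cons.
exact: tangentD.
Qed.

Lemma tangent_prod (I : Type) (r : seq I) (F G : I -> R -> R) t :
  (forall i, tangent (F i) (G i) t) ->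
  tangent (fun s => \prod_(i <- r) F i s) (fun s => \prod_(i <- r) G i s) t.
Proof.
move=> FG; elim: r => [|a r IH].
  by under eq_fun do rewrite big_nil; under [X in tangent _ X _]eq_fun do rewrite big_nil;
     exact: tangent_cst.
under eq_fun do rewrite big_cons; under [X in tangent _ X _]eq_fun do rewrite big_cons.
exact: tangentM.
Qed.

Definition mxtangent (m n : nat) (X Y : R -> 'M[R]_(m, n)) t :=
  forall i j, tangent (fun s => X s i j) (fun s => Y s i j) t.

Lemma tangent_det (k : nat) (X Y : R -> 'M[R]_k) t : mxtangent X Y t ->
  tangent (fun s => \det (X s)) (fun s => \det (Y s)) t.
Proof.
move=> XY; apply: tangent_sum => s; apply: tangentM; first exact: tangent_cst.
by apply: tangent_prod => i.
Qed.

Lemma tangent_near f g t (e : R) : tangent f g t -> 0 < e ->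
  \forall h \near 0^'+, `|f (t + h) - g (t + h)| <= e * h.
Proof.
move=> [d [fd gd fg]] e0.
have D : is_derive t (1 : R) (f - g) 0.
  by rewrite -(subrr d); exact: is_deriveB.
have /cvg_ex[l C] := @ex_derive _ _ _ _ _ _ _ D.
have l0 : l = 0.
  by rewrite -(@derive_val _ _ _ _ _ _ _ D); apply/esym/cvg_lim.
rewrite l0 in C.
have N := cvgr0_norm_le _ (cvg_dnbhs_at_right C) _ e0.
near=> h.
have h0 : 0 < h by near: h; exact: nbhs_right_gt.
have : `|h^-1 *: (((f - g) \o shift t) (h *: 1) - (f - g) t)| <= e.
  by near: h; exact: N.
rewrite /= !fctE fg subrr subr0 normrM normfV (gtr0_norm h0) ler_pdivrMl //.
by rewrite mulrC [h *: 1]mulr1 (addrC t).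
Unshelve. all: by end_near. Qed.

Lemma is_derive_affine (a b t : R) : is_derive t (1 : R) (fun s => a + (s - t) * b) b.
Proof.
have -> : (fun s => a + (s - t) * b) = cst (a - t * b) + b \*: (id : R -> R).
  by apply/funext => s; rewrite !fctE /= [b *: s]mulrC; ring.
by apply: is_derive_eq; rewrite add0r [b *: _]mulr1.
Qed.

Lemma tangent_affine f (d t : R) : is_derive t (1 : R) f d ->
  tangent f (fun s => f t + (s - t) * d) t.
Proof.
move=> fd; exists d; split=> //; first exact: is_derive_affine.
by rewrite subrr mul0r addr0.
Qed.

Lemma is_derive_mx (m n : nat) (X : R -> 'M[R]_(m, n)) t (D : 'M[R]_(m, n)) :
  is_derive t (1 : R) X D -> forall i j, is_derive t (1 : R) (fun s => X s i j) (D i j).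
Proof.
move=> XD i j; have dX := @ex_derive _ _ _ _ _ _ _ XD.
have dXij := (derivable_mxP X t 1).1 dX i j.
apply: DeriveDef => //; rewrite -(@derive_val _ _ _ _ _ _ _ XD) derive_mx // mxE //.
Qed.

Lemma derive1_mxE (m n : nat) (X : R -> 'M[R]_(m, n)) t (D : 'M[R]_(m, n)) :
  (forall i j, is_derive t (1 : R) (fun s => X s i j) (D i j)) -> derive1 X t = D.
Proof.
move=> XD; rewrite derive1E derive_mx; last first.
  by apply/derivable_mxP => i j; exact: (@ex_derive _ _ _ _ _ _ _ (XD i j)).
by apply/matrixP => i j; rewrite mxE (@derive_val _ _ _ _ _ _ _ (XD i j)).
Qed.

End Tangent.

(** * Entrywise convergence of matrices *)

Section MxCvg.
Variables (R : realType) (T : Type) (F : set_system T).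
Context {FF : Filter F}.

Lemma cvg_mxP (m n : nat) (X : T -> 'M[R]_(m, n)) (M : 'M[R]_(m, n)) :
  (forall i j, (fun s => X s i j) @ F --> M i j) -> X @ F --> M.
Proof.
move=> h; apply/cvgrPdist_le => e e0; near=> s.
rewrite /Num.Def.normr/= mx_normrE (bigmax_le _ (ltW e0)) //= => i _.
rewrite !mxE; move: i; near: s; apply: filter_forall => -[i j] /=.
exact: ((cvgrPdist_le _ _).1 (h i j)).
Unshelve. all: by end_near. Qed.

Lemma cvg_mx_coord (m n : nat) (X : T -> 'M[R]_(m, n)) (M : 'M[R]_(m, n)) i j :
  X @ F --> M -> (fun s => X s i j) @ F --> M i j.
Proof.
move=> h; apply/cvgrPdist_le => e e0; near=> s.
have : `|M - X s| <= e by near: s; exact: ((cvgrPdist_le _ _).1 h).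
apply: le_trans; rewrite [leRHS]/Num.Def.normr/= mx_normrE.
apply: le_trans; last exact: (le_bigmax _ _ (i, j)).
by rewrite !mxE.
Unshelve. all: by end_near. Qed.

Lemma cvg_sum_fun (I : Type) (r : seq I) (f : I -> T -> R) (a : I -> R) :
  (forall i, f i @ F --> a i) ->
  (fun s => \sum_(i <- r) f i s) @ F --> \sum_(i <- r) a i.
Proof.
move=> h; elim: r => [|x r IH].
  by rewrite big_nil; under eq_fun do rewrite big_nil; exact: cvg_cst.
by rewrite big_cons; under eq_fun do rewrite big_cons; exact: cvgD.
Qed.

Lemma cvg_prod_fun (I : Type) (r : seq I) (f : I -> T -> R) (a : I -> R) :
  (forall i, f i @ F --> a i) ->
  (fun s => \prod_(i <- r) f i s) @ F --> \prod_(i <- r) a i.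
Proof.
move=> h; elim: r => [|x r IH].
  by rewrite big_nil; under eq_fun do rewrite big_nil; exact: cvg_cst.
by rewrite big_cons; under eq_fun do rewrite big_cons; exact: cvgM.
Qed.

Lemma cvg_det (k : nat) (X : T -> 'M[R]_k) (M : 'M[R]_k) :
  (forall i j, (fun s => X s i j) @ F --> M i j) ->
  (fun s => \det (X s)) @ F --> \det M.
Proof.
move=> h; apply: cvg_sum_fun => s; apply: cvgM; first exact: cvg_cst.
by apply: cvg_prod_fun => i.
Qed.

Lemma cvg_mulmxr (m n p : nat) (X : T -> 'M[R]_(m, n)) (M : 'M[R]_(m, n)) (N : 'M[R]_(n, p)) :
  X @ F --> M -> (fun s => X s *m N) @ F --> M *m N.
Proof.
move=> XM; apply: cvg_mxP => i j; rewrite mxE; under eq_fun do rewrite mxE.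
by apply: cvg_sum_fun => r; apply: cvgM; [exact: cvg_mx_coord|exact: cvg_cst].
Qed.

End MxCvg.

(** * Multiplicative and additive compounds *)

Section Compounds.
Variable R : realType.

Lemma mcompE (p q k : nat) (C : 'M[R]_(p, q)) I J :
  mcomp k C I J = \det (mxsub (kidx I) (kidx J) C).
Proof. by rewrite mxE. Qed.

Lemma mcomp1 (p k : nat) : mcomp k (1%:M : 'M[R]_p) = 1%:M.
Proof.
apply/matrixP => I J; rewrite mcompE [RHS]mxE.
have [->|IJ] := eqVneq I J.
  rewrite -[RHS](det1 _ k); congr (\det _); apply/matrixP => r s.
  by rewrite !mxE (inj_eq (@kidx_inj _ _ J)).
have [r rJ] : exists r, kidx I r \notin val (enum_val J).
  apply/existsP; rewrite -negb_forall; apply: contra IJ => /forallP h.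
  apply/eqP/enum_val_inj/val_inj/eqP; rewrite eqEcard (eqP (valP (enum_val I))).
  rewrite (eqP (valP (enum_val J))) leqnn andbT -image_ksub_idx.
  by apply/fintype.subsetP => x /imsetP[s _ ->]; exact: h.
apply: big1 => s _; rewrite (bigD1 r) //= !mxE.
case: eqP => [E|_]; last by rewrite mul0r mulr0.
by case/negP: rJ; rewrite E -image_ksub_idx; apply: imset_f.
Qed.

Lemma mcomp_mul (p q r k : nat) (A : 'M[R]_(p, q)) (B : 'M[R]_(q, r)) :
  mcomp k (A *m B) = mcomp k A *m mcomp k B.
Proof.
apply/matrixP => I J; rewrite mcompE [RHS]mxE.
have -> : mxsub (kidx I) (kidx J) (A *m B) = rowsub (kidx I) A *m colsub (kidx J) B.
  by apply/matrixP => i j; rewrite !mxE; apply: eq_bigr => s _; rewrite !mxE.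
rewrite Cauchy_Binet; apply: eq_bigr => K _; rewrite !mcompE.
by congr (_ * _); congr (\det _); apply/matrixP => i j; rewrite !mxE.
Qed.

Lemma mxpow_entry_le (p : nat) (A : 'M[R]_p) (c : R) l i j :
  \sum_i \sum_j `|A i j| <= c -> `|(A ^+ l) i j| <= c ^+ l.
Proof.
move=> Ac; have c0 : 0 <= c.
  by apply: le_trans Ac; apply: sumr_ge0 => u _; apply: sumr_ge0.
elim: l i j => [|l IH] i j; first by rewrite !expr0 mxE; case: eqP; rewrite ?normr1 ?normr0.
rewrite !exprS mxE; apply: le_trans (ler_norm_sum _ _ _) _.
apply: (@le_trans _ _ ((\sum_j `|A i j|) * c ^+ l)).
  by rewrite mulr_suml; apply: ler_sum => r _; rewrite normrM ler_wpM2l.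
rewrite ler_wpM2r ?exprn_ge0 //; apply: le_trans Ac.
by rewrite [leRHS](bigD1 i) //= lerDl; apply: sumr_ge0 => u _; apply: sumr_ge0.
Qed.

(** [mexp] is a [limn], so convergence has to be proved: each entry is dominated by the scalar
    exponential series of the sum of the absolute values of all entries of [A]. *)
Lemma mexp_entry (p : nat) (A : 'M[R]_p) i j :
  series (fun l => (A ^+ l) i j / l`!%:R) @ \oo --> mexp A i j.
Proof.
pose c := \sum_i \sum_j `|A i j|.
have cv u v : cvgn (series (fun l => (A ^+ l) u v / l`!%:R)).
  apply: normed_cvg; apply: series_le_cvg (is_cvg_series_exp_coeff c) => l.
  - exact: normr_ge0.
  - by rewrite /exp_coeff /= divr_ge0 // exprn_ge0 //; apply: sumr_ge0 => a _; apply: sumr_ge0.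
  - rewrite /exp_coeff /= normrM normfV [ `|_%:R| ]ger0_norm // ler_wpM2r ?invr_ge0 //.
    exact: mxpow_entry_le.
pose M : 'M[R]_p := \matrix_(u, v) limn (series (fun l => (A ^+ l) u v / l`!%:R)).
have E (u v : 'I_p) : (fun n => series (fun l : nat => (l`!%:R)^-1 *: A ^+ l) n u v)
    = series (fun l => (A ^+ l) u v / l`!%:R).
  apply/funext => n; rewrite /series /= summxE; apply: eq_bigr => l _.
  by rewrite mxE mulrC.
have -> : mexp A = M.
  rewrite /mexp; apply: cvg_lim => //; apply: cvg_mxP => u v.
  by rewrite E mxE; exact: cv.
by rewrite mxE; exact: cv.
Qed.

(** The difference consists of the terms of order at least two. For [|t| <= 1] each of them carries
    a factor [t^2], and what remains is bounded by the scalar exponential series. *)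
Lemma mexp_affine_le (p : nat) (A : 'M[R]_p) (t : R) i j : `|t| <= 1 ->
  `|mexp (t *: A) i j - (1%:M + t *: A) i j|
  <= t ^+ 2 * expR (\sum_i \sum_j `|A i j|).
Proof.
set c := \sum_i _ => t1.
have c0 : 0 <= c by apply: sumr_ge0 => u _; apply: sumr_ge0.
have tc : \sum_i \sum_j `|(t *: A) i j| <= `|t| * c.
  rewrite mulr_sumr; apply: ler_sum => u _; rewrite mulr_sumr; apply: ler_sum => v _.
  by rewrite mxE normrM.
have C := @mexp_entry _ (t *: A) i j.
have C' : (fun n => `|series (fun l => ((t *: A) ^+ l) i j / l`!%:R) n - (1%:M + t *: A) i j|)
    @ \oo --> `|mexp (t *: A) i j - (1%:M + t *: A) i j|.
  by apply: cvg_norm; apply: cvgB C _; exact: cvg_cst.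
apply: (cvgr_to_le C'); near=> n.
have n2 : (2 <= n)%N by near: n; exists 2%N.
rewrite -(subnKC n2) /series /= big_nat_recl // big_nat_recl // expr0 expr1.
set S := (X in _ + (_ + X)).
rewrite (_ : 0`! = 1)%N // (_ : 1`! = 1)%N // !divr1 [(1%:M + _) i j]mxE.
have -> (a b : R) : a + (b + S) - (a + b) = S by ring.
rewrite /S.
apply: le_trans (ler_norm_sum _ _ _) _.
apply: (@le_trans _ _ (\sum_(0 <= l < n - 2) t ^+ 2 * exp_coeff c l.+2)).
  apply: ler_sum => l _; rewrite normrM normfV [ `|_%:R| ]ger0_norm //.
  rewrite /exp_coeff /= mulrA ler_wpM2r ?invr_ge0 //.
  apply: le_trans (mxpow_entry_le _ _ _ tc) _.
  rewrite exprMn ler_wpM2r ?exprn_ge0 // -addn2 exprD.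
  have -> : `|t| ^+ 2 = t ^+ 2 by rewrite -normrX ger0_norm ?sqr_ge0.
  by rewrite ler_piMl ?sqr_ge0 // exprn_ile1.
rewrite -mulr_sumr ler_wpM2l ?sqr_ge0 //.
have mono : {homo series (exp_coeff c) : a b / (a <= b)%N >-> a <= b}.
  apply/nondecreasing_seqP => a; rewrite /series /= big_nat_recr //= lerDl.
  by rewrite /exp_coeff /= divr_ge0 // exprn_ge0.
apply: le_trans (nondecreasing_cvgn_le mono (is_cvg_series_exp_coeff c) n).
rewrite -[in leRHS](subnKC n2) /series /= 2?big_nat_recl // addrA lerDr.
by rewrite /exp_coeff /= addr_ge0 // divr_ge0 // exprn_ge0.
Unshelve. all: by end_near. Qed.

Lemma mexp_tangent (p : nat) (A : 'M[R]_p) :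
  mxtangent (fun t => mexp (t *: A)) (fun t => 1%:M + t *: A) 0.
Proof.
move=> i j; pose f s := mexp (s *: A) i j; pose g s := (1%:M + s *: A) i j.
rewrite -[X in tangent X]/f -[X in tangent _ X]/g.
have le t : `|t| <= 1 -> `|f t - g t| <= t ^+ 2 * expR (\sum_i \sum_j `|A i j|).
  by move=> t1; exact: mexp_affine_le.
set c := expR _ in le.
have c0 : 0 < c by exact: expR_gt0.
have fg : f 0 = g 0.
  apply/eqP; rewrite -subr_eq0 -normr_le0; apply: le_trans (le 0 _) _.
    by rewrite normr0.
  by rewrite expr0n mul0r.
have gd : is_derive (0 : R) (1 : R) g (A i j).
  have -> : g = fun s : R => (1%:M : 'M[R]_p) i j + (s - 0) * A i j.
    by apply/funext => s; rewrite /g !mxE subr0.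
  exact: is_derive_affine.
suff dd : is_derive (0 : R) (1 : R) (f - g) 0.
  exists (A i j); split=> //.
  have -> : f = (f - g) + g by apply/funext => s; rewrite !fctE subrK.
  by rewrite -[A i j]add0r; exact: is_deriveD.
have C : (fun h : R => h^-1 *: (((f - g) \o shift 0) (h *: 1) - (f - g) 0)) @ 0^' --> (0 : R).
  apply/cvgrPdist_le => e e0; near=> h.
  have h0 : h != 0 by near: h; exact: nbhs_dnbhs_neq.
  have h1 : `|h| <= 1 by near: h; apply: dnbhs0_le.
  have hc : `|h| <= e / c by near: h; apply: dnbhs0_le; rewrite divr_gt0.
  rewrite /= !fctE fg subrr subr0 [h *: 1]mulr1 addr0 sub0r normrN normrM normfV.
  rewrite ler_pdivrMl ?normr_gt0 //; apply: le_trans (le _ h1) _.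
  rewrite -[h ^+ 2]ger0_norm ?sqr_ge0 // normrX expr2 -mulrA ler_wpM2l //.
  by rewrite -ler_pdivlMr.
have D : derivable (f - g) (0 : R) (1 : R) by apply/cvg_ex; exists 0.
by apply: DeriveDef => //; exact/cvg_lim.
Unshelve. all: by end_near. Qed.

Lemma mcomp_tangent (p q k : nat) (X Y : R -> 'M[R]_(p, q)) t :
  mxtangent X Y t ->
  mxtangent (fun s => mcomp k (X s)) (fun s => mcomp k (Y s)) t.
Proof.
move=> XY I J; under eq_fun do rewrite mcompE.
under [X in tangent _ X _]eq_fun do rewrite mcompE.
apply: tangent_det => r s; under eq_fun do rewrite mxE.
by under [X in tangent _ X _]eq_fun do rewrite mxE; exact: XY.
Qed.

(** The additive compound is defined through the exponential; since [exp(tA)] and [1 + tA] are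
    tangent at 0 and minors preserve tangency, it is equally the derivative of the compound of
    [1 + tA]. *)
Lemma mcomp_acomp_tangent (p k : nat) (A : 'M[R]_p) :
  mxtangent (fun t => mcomp k (1%:M + t *: A)) (fun t => 1%:M + t *: acomp k A) 0.
Proof.
have T := mcomp_tangent (k := k) (@mexp_tangent _ A).
(* The derivatives whose existence tangency asserts, collected in a matrix; they supply the
   derivability that makes [derive1] in [acomp] meaningful. *)
pose D : 'M[R]_(#|{: ksub p k}|) := \matrix_(I, J) sval (cid (T I J)).
have DE : acomp k A = D.
  apply: derive1_mxE => I J; rewrite mxE.
  by case: (svalP (cid (T I J))).
move=> I J.
have : is_derive (0 : R) (1 : R) (fun t => mcomp k (1%:M + t *: A) I J) (acomp k A I J).
  by rewrite DE mxE; case: (svalP (cid (T I J))).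
move=> /tangent_affine; rewrite scale0r addr0 mcomp1.
by congr (tangent _ _ _); apply/funext => s; rewrite subr0 !mxE.
Qed.

(** The link between the hypothesis, on additive compounds, and the estimate, on multiplicative
    ones. They differ by [o(h)], which the gap between the measure and [c] absorbs. *)
Lemma near_indnorm_mcomp (e : \bar R) (p k : nat) (A : 'M[R]_p) (c : R) :
  (1%:E <= e)%E -> (0 < #|{: ksub p k}|)%N ->
  mxmeasure (@lpnorm R e _) (acomp k A) < c ->
  \forall h \near 0^'+,
    indnorm (@lpnorm R e _) (mcomp k (1%:M + h *: A)) <= 1 + h * c.
Proof.
move=> e1 d0 mc.
set N := #|{: ksub p k}| in d0 mc *.
set m := mxmeasure _ _ in mc.
have [c1 mc1 c1c] : exists2 c1, m < c1 & c1 < c.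
  by exists ((m + c) / 2); rewrite ?midf_lt.
(* Chosen so that an error of [eps * h] in each of the [N * N] entries costs at most
   [(c - c1) * h]. *)
pose eps := (c - c1) / (N%:R * N%:R + 1).
have NN : 0 < N%:R * N%:R + 1 :> R by rewrite ltr_wpDl // mulr_ge0.
have eps0 : 0 < eps by rewrite divr_gt0 // subr_gt0.
have H1 := near_indnorm_le (lpnorm_is_norm e1 N) (@le_lpnorm _ _ e1 N)
  (@lpnorm_le_sum _ _ e1 N) d0 mc1.
have H2 I J := tangent_near (@mcomp_acomp_tangent p k A I J) eps0.
near=> h.
have h0 : 0 < h by near: h; exact: nbhs_right_gt.
have B : forall I J,
    `|mcomp k (1%:M + h *: A) I J - (1%:M + h *: acomp k A) I J| <= eps * h.
  near: h; apply: filter_forall => I; apply: filter_forall => J.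
  by have := H2 I J; apply: filterS => h; rewrite add0r.
have -> : mcomp k (1%:M + h *: A) =
    (1%:M + h *: acomp k A) + (mcomp k (1%:M + h *: A) - (1%:M + h *: acomp k A)).
  by rewrite subrKC.
apply: le_trans (indnormD (lpnorm_is_norm e1 N) (@le_lpnorm _ _ e1 N)
  (@lpnorm_le_sum _ _ e1 N) _ _) _.
have hh1 : indnorm (@lpnorm R e _) (1%:M + h *: acomp k A) <= 1 + h * c1.
  by near: h; exact: H1.
apply: (@le_trans _ _ ((1 + h * c1) + N%:R * N%:R * (eps * h))).
  apply: lerD => //.
  apply: le_trans (indnorm_le_sum (@le_lpnorm _ _ e1 N)
    (@lpnorm_le_sum _ _ e1 N) _) _.
  apply: (@le_trans _ _ (\sum_(I < N) \sum_(J < N) eps * h)).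
    by apply: ler_sum => I _; apply: ler_sum => J _; rewrite !mxE; have := B I J; rewrite !mxE.
  by rewrite !sumr_const card_ord -mulrnA -[leLHS]mulr_natl natrM.
have : N%:R * N%:R * eps <= c - c1.
  by rewrite /eps mulrCA ler_piMr ?subr_ge0 ?(ltW c1c) // ler_pdivrMr // mul1r lerDl.
move=> /(ler_wpM2l (ltW h0)); rewrite mulrBr; lra.
Unshelve. all: by end_near. Qed.

End Compounds.

(** * Dini derivatives and the Jacobian of the interconnection *)

Section Dini.
Variable R : realType.

Lemma dini_exp_decay (g : R -> R) (eta eta' : R) :
  0 <= g 0 -> eta' < eta -> g @ 0^'+ --> g 0 -> (forall t : R, 0 < t -> g @ t --> g t) ->
  (forall t e : R, 0 < t -> 0 < e ->
    \forall h \near 0^'+, g (t + h) <= g t + h * (e - eta * g t)) ->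
  forall t : R, 0 <= t -> g t <= expR (- (eta' * t)) * g 0.
Proof.
move=> g0 ee c0 ct D T T0.
(* Compare [g] with the strictly slower decay [expR (- (eta' * s)) * c], [c > g 0],
   at the last time [s] up to which it stays below. *)
suff H (c : R) : g 0 < c -> g T <= expR (- (eta' * T)) * c.
  rewrite mulrC -ler_pdivrMr ?expR_gt0 //; apply/ler_addgt0Pr => e e0.
  by rewrite ler_pdivrMr ?expR_gt0 // mulrC; apply: H; rewrite ltrDl.
move=> gc; have cp : 0 < c by exact: le_lt_trans gc.
pose phi (s : R) := expR (- (eta' * s)) * c.
have phip (s : R) : 0 < phi s by rewrite mulr_gt0 ?expR_gt0.
have phic (s : R) : phi @ s --> phi s.
  apply: cvgM; last exact: cvg_cst.
  apply: continuous_comp; last exact: continuous_expR.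
  by apply: cvgN; apply: cvgM; [exact: cvg_cst|exact: cvg_id].
have phiD (s h : R) : 0 <= h -> phi s * (1 - eta' * h) <= phi (s + h).
  move=> h0; rewrite /phi (_ : - (eta' * (s + h)) = - (eta' * s) - eta' * h); last by ring.
  rewrite expRD mulrAC ler_pM2r //.
  by rewrite ler_pM2l ?expR_gt0 // expR_ge1Dx.
pose A := [set s | 0 <= s <= T /\ forall r, 0 <= r <= s -> g r <= phi r].
have A0 : A 0.
  split; first by rewrite lexx.
  move=> r; rewrite -eq_le => /eqP <-.
  by rewrite /phi mulr0 oppr0 expR0 mul1r ltW.
have ubA : has_ubound A by exists T => s [/andP[_ ]].
have hsA : has_sup A by split => //; exists 0.
pose s := sup A.
have s0 : 0 <= s by exact: ub_le_sup.
have sT : s <= T by apply: ge_sup; [exists 0|move=> u [/andP[_ ]]].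
have below r : 0 <= r -> r < s -> g r <= phi r.
  move=> r0 rs; have e0 : 0 < s - r by rewrite subr_gt0.
  have [u [_ Au] ] := sup_adherent e0 hsA; rewrite subKr => ru.
  by apply: Au; rewrite r0 ltW.
have at_s : g s <= phi s.
  have [<-|s_neq0] := eqVneq 0 s.
    by rewrite /phi mulr0 oppr0 expR0 mul1r ltW.
  have sp : 0 < s by rewrite lt_def eq_sym s_neq0.
  have C : (fun r => g r - phi r) @ s^'- --> g s - phi s.
    apply: cvg_at_left_filter; apply: cvgB; [exact: ct|exact: phic].
  rewrite -subr_le0; apply: (cvgr_to_le C); near=> r.
  rewrite subr_le0; apply: below.
    by apply: ltW; near: r; exact: nbhs_left_gt.
  by near: r; exact: nbhs_left_lt.
have near_s : \forall h \near 0^'+, g (s + h) <= phi (s + h).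
  have [gs|gs] := ltP (g s) (phi s).
    have C : (fun r => phi r - g r) @ s^'+ --> phi s - g s.
      apply: cvgB; first by apply: cvg_at_right_filter; exact: phic.
      have [<-//|s_neq0] := eqVneq 0 s.
      by apply: cvg_at_right_filter; apply: ct; rewrite lt_def eq_sym s_neq0.
    have [e /= e0 he] : \forall r \near s^'+, 0 < phi r - g r.
      by apply: (cvgr_gt _ C); rewrite subr_gt0.
    exists e => //= h /=; rewrite sub0r normrN => he' h0.
    rewrite -subr_ge0; apply/ltW/he; last by rewrite ltrDl.
    by rewrite /= opprD addrA subrr sub0r normrN.
  (* Where the curves touch, [s] is positive because [g 0 < c]. With slack [(eta - eta') * phi s]
     the growth bound becomes the tangent line of [phi] at [s], which lies below [phi] by [phiD]. *)
  have E : g s = phi s by apply/eqP; rewrite eq_le at_s gs.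
  have sp : 0 < s.
    rewrite lt_def s0 andbT; apply/eqP => sE; move: gs.
    by rewrite sE /phi mulr0 oppr0 expR0 mul1r leNgt gc.
  have e0 : 0 < (eta - eta') * phi s by rewrite mulr_gt0 // subr_gt0.
  have := D s _ sp e0; apply: filter_app; near=> h => /le_trans; apply.
  have h0 : 0 <= h by apply: ltW; near: h; exact: nbhs_right_gt.
  apply: le_trans (phiD s h h0); rewrite E.
  by rewrite le_eqVlt; apply/orP; left; apply/eqP; ring.
suff sE : s = T by rewrite -sE.
apply/eqP; rewrite eq_le sT /= leNgt; apply/negP => slt.
have [e /= e0 he] := near_s.
pose d := Num.min (e / 2) (T - s).
have d0 : 0 < d by rewrite lt_min divr_gt0 // subr_gt0.
have de : d < e by rewrite gt_min; apply/orP; left; lra.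
have dT : s + d <= T by rewrite -lerBrDl ge_min lexx orbT.
suff Asd : A (s + d).
  by have := ub_le_sup ubA Asd; rewrite -/s gerDl leNgt d0.
split; first by rewrite addr_ge0 ?(ltW d0).
move=> r /andP[r0 rsd]; have [rs|rs|->] := ltgtP r s; [exact: below| |exact: at_s].
have -> : r = s + (r - s) by rewrite subrKC.
apply: he; last by rewrite subr_gt0.
by rewrite /= sub0r normrN gtr0_norm ?subr_gt0 //; apply: le_lt_trans de; rewrite lerBlDl.
Unshelve. all: by end_near. Qed.

End Dini.

(** * Block form of the Jacobian *)

Section Jacobian.
Variable R : realType.

Lemma mulmxr_differentiable (a b : nat) (M : 'M[R]_(a, b)) (x : 'rV[R]_a) :
  differentiable (fun u : 'rV[R]_a => u *m M) x.
Proof.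
apply: (@linear_differentiable _ _ _ (mulmxr M)) => u.
exact: (@cvg_mulmxr _ _ (nbhs u) (nbhs_filter u) _ _ _ id).
Qed.

Lemma pjacE (a b : nat) (g : 'rV[R]_a -> 'rV[R]_b) x i j : differentiable g x ->
  pjac g x i j = 'D_(delta_mx 0 j) (fun u => g u 0 i) x.
Proof.
move=> dg; rewrite mxE -deriveE // derive_mx ?mxE //; exact: diff_derivable.
Qed.

(** A directional derivative sees only one line, so partial derivatives of the whole system can be
    compared with those of its blocks, which live on other spaces. *)
Lemma eq_derive_line (V W : normedModType R) (f : V -> R) (g : W -> R) a v b w :
  (forall h : R, f (h *: v + a) = g (h *: w + b)) -> 'D_v f a = 'D_w g b.
Proof.
move=> fg; have E : f a = g b by have := fg 0; rewrite !scale0r !add0r.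
rewrite /derive E.
have -> // : (fun h : R => h^-1 *: ((f \o shift a) (h *: v) - g b))
    = (fun h : R => h^-1 *: ((g \o shift b) (h *: w) - g b)).
by apply/funext => h; rewrite /= fg.
Qed.

Lemma pjac_series (n m : nat) (f1 : R -> 'rV[R]_n -> 'rV[R]_n)
    (f2 : R -> 'rV[R]_m -> 'rV[R]_n -> 'rV[R]_m) t (x : 'rV[R]_(n + m)) :
  C1 (fun p : R * 'rV[R]_n => f1 p.1 p.2) ->
  C1 (fun p : R * ('rV[R]_m * 'rV[R]_n) => f2 p.1 p.2.1 p.2.2) ->
  pjac (series_sys f1 f2 t) x =
  block_mx (pjac (f1 t) (lsubmx x)) 0
    (pjac (fun y => f2 t (rsubmx x) y) (lsubmx x))
    (pjac (fun y => f2 t y (lsubmx x)) (rsubmx x)).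
Proof.
move=> [d1 _] [d2 _].
have D1 y : differentiable (f1 t) y.
  apply: (@differentiable_comp _ _ _ _ (fun y => (t, y)) (fun p : R * 'rV[R]_n => f1 p.1 p.2)) => //.
have D2 y1 y2 : differentiable (fun p : 'rV[R]_m * 'rV[R]_n => f2 t p.1 p.2) (y1, y2).
  apply: (@differentiable_comp _ _ _ _ (fun y => (t, y))
    (fun p : R * ('rV[R]_m * 'rV[R]_n) => f2 p.1 p.2.1 p.2.2)) => //.
have D21 y1 y2 : differentiable (fun y => f2 t y1 y) y2.
  apply: (@differentiable_comp _ _ _ _ (fun y => (y1, y)) (fun p => f2 t p.1 p.2)) => //.
have D22 y1 y2 : differentiable (fun y => f2 t y y2) y1.
  apply: (@differentiable_comp _ _ _ _ (fun y => (y, y2)) (fun p => f2 t p.1 p.2)) => //.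
have DS : differentiable (series_sys f1 f2 t) x.
  (* Projections and concatenation of rows are written as matrix products, which are known to be
     differentiable. *)
  pose L : 'M[R]_(n + m, n) := col_mx 1%:M 0.
  pose L' : 'M[R]_(n + m, m) := col_mx 0 1%:M.
  have LE u : u *m L = lsubmx u.
    by rewrite -{1}[u]hsubmxK mul_row_col mulmx1 mulmx0 addr0.
  have LE' u : u *m L' = rsubmx u.
    by rewrite -{1}[u]hsubmxK mul_row_col mulmx1 mulmx0 add0r.
  have -> : series_sys f1 f2 t =
      (fun u => f1 t (u *m L) *m row_mx 1%:M 0)
      + (fun u => f2 t (u *m L') (u *m L) *m row_mx 0 1%:M).
    apply/funext => u; rewrite fctE LE LE' !mul_mx_row !mulmx1 !mulmx0.
    by rewrite add_row_mx addr0 add0r.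
  apply: differentiableD.
    apply: (@differentiable_comp _ _ _ _ (fun u => f1 t (u *m L)) (mulmxr _)).
      apply: (@differentiable_comp _ _ _ _ (mulmxr L) (f1 t)) => //.
      exact: mulmxr_differentiable.
    exact: mulmxr_differentiable.
  apply: (@differentiable_comp _ _ _ _ (fun u => f2 t (u *m L') (u *m L)) (mulmxr _)).
    apply: (@differentiable_comp _ _ _ _ (fun u => (u *m L', u *m L))
      (fun p => f2 t p.1 p.2)) => //.
    by apply: differentiable_pair; exact: mulmxr_differentiable.
  exact: mulmxr_differentiable.
have lsD (h : R) (j : 'I_n) : lsubmx (h *: delta_mx 0 (lshift m j) + x)
    = h *: delta_mx 0 j + lsubmx x.
  by apply/matrixP => u v; rewrite !mxE (inj_eq (@lshift_inj _ _)).
have rsD (h : R) (j : 'I_n) : rsubmx (h *: delta_mx 0 (lshift m j) + x) = rsubmx x.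
  by apply/matrixP => u v; rewrite !mxE eq_rlshift andbF mulr0 add0r.
have lsD' (h : R) (j : 'I_m) : lsubmx (h *: delta_mx 0 (rshift n j) + x) = lsubmx x.
  by apply/matrixP => u v; rewrite !mxE eq_lrshift andbF mulr0 add0r.
have rsD' (h : R) (j : 'I_m) : rsubmx (h *: delta_mx 0 (rshift n j) + x)
    = h *: delta_mx 0 j + rsubmx x.
  by apply/matrixP => u v; rewrite !mxE (inj_eq (@rshift_inj _ _)).
apply/matrixP => i j; rewrite pjacE //.
case: (split_ordP i) => i' ->; case: (split_ordP j) => j' ->.
- rewrite block_mxEul pjacE //; apply: eq_derive_line => h.
  by rewrite /series_sys !row_mxEl lsD.
- rewrite block_mxEur mxE -[RHS](derive_cst (f1 t (lsubmx x) 0 i' : R) x (delta_mx 0 (rshift n j'))).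
  apply: eq_derive_line => h.
  by rewrite /series_sys !row_mxEl lsD'.
- rewrite block_mxEdl pjacE //; apply: eq_derive_line => h.
  by rewrite /series_sys !row_mxEr lsD rsD.
- rewrite block_mxEdr pjacE //; apply: eq_derive_line => h.
  by rewrite /series_sys !row_mxEr lsD' rsD'.
Qed.

End Jacobian.

(** * The norm on k-vectors *)

Section DetLipschitz.
Variable R : realType.

(** The bound on the product is carried through the induction because, with [P] and [Q] the
    perturbed and unperturbed tails, the new difference is [a (P - Q) + b P]. The constant depends
    only on the index list. *)
Lemma prod_lipschitz (I : Type) (r : seq I) : exists2 C : R, 0 <= C &
  forall (a b : I -> R) e, 0 <= e <= 1 -> (forall i, `|a i| <= 1) ->
  (forall i, `|b i| <= e) ->
  `|\prod_(i <- r) (a i + b i)| <= C /\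
  `|\prod_(i <- r) (a i + b i) - \prod_(i <- r) a i| <= C * e.
Proof.
elim: r => [|x r [C C0 IH]].
  exists 1 => // a b e /andP[e0 _] a1 be.
  by rewrite !big_nil subrr normr0 normr1 mul1r.
exists (C + C); first by rewrite addr_ge0.
move=> a b e e01 a1 be; have [e0 e1] := andP e01.
have [h1 h2] := IH a b e e01 a1 be; rewrite !big_cons.
set P := \prod_(i <- r) (a i + b i) in h1 h2 *; set Q := \prod_(i <- r) a i in h2 *.
have aP : `|a x * P| <= C by rewrite normrM -[C]mul1r ler_pM.
have bP : `|b x * P| <= e * C by rewrite normrM ler_pM.
have aPQ : `|a x * (P - Q)| <= C * e by rewrite normrM -[C * e]mul1r ler_pM.
split.
  rewrite mulrDl; apply: le_trans (ler_normD _ _) _; apply: lerD => //.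
  by apply: le_trans bP _; rewrite ler_piMl.
have -> : (a x + b x) * P - a x * Q = a x * (P - Q) + b x * P by ring.
by apply: le_trans (ler_normD _ _) _; rewrite mulrDl (mulrC C) lerD // mulrC.
Qed.

Lemma det_lipschitz (k : nat) : exists2 C : R, 0 <= C &
  forall (A B : 'M[R]_k) e, 0 <= e <= 1 ->
  (forall i j, `|A i j| <= 1) -> (forall i j, `|B i j| <= e) ->
  `|\det (A + B) - \det A| <= C * e.
Proof.
have [C C0 H] := prod_lipschitz (index_enum 'I_k).
exists (\sum_(s : 'S_k) C); first by apply: sumr_ge0.
move=> A B e e01 A1 Be; rewrite /determinant -sumrB mulr_suml.
apply: le_trans (ler_norm_sum _ _ _) _; apply: ler_sum => s _.
rewrite -mulrBr normrM normrX normrN1 expr1n mul1r.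
under eq_bigr do rewrite mxE.
by have [] := H (fun i => A i (s i)) (fun i => B i (s i)) e e01
  (fun i => A1 i (s i)) (fun i => Be i (s i)).
Qed.

End DetLipschitz.

(** * Block components of a k-vector *)

Section Wedge.
Variables (R : realType) (k : nat).

(** The coordinates of [X^(k) v], extended from increasing tuples to all index maps so that
    regrouping indices by block needs no sign bookkeeping. *)
Definition wedge (N : nat) (X : 'M[R]_N) (v : 'cV[R]_(#|{: ksub N k}|))
    (f : 'I_k -> 'I_N) : R :=
  \sum_J \det (mxsub f (kidx J) X) * v J 0.

Lemma wedge_kidx (N : nat) (X : 'M[R]_N) v K :
  wedge X v (kidx K) = (mcomp k X *m v) K 0.
Proof. by rewrite mxE; apply: eq_bigr => J _; rewrite mcompE. Qed.

Lemma wedge_mul (N : nat) (A X : 'M[R]_N) v f :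
  wedge (A *m X) v f = \sum_K \det (mxsub f (kidx K) A) * wedge X v (kidx K).
Proof.
rewrite /wedge; under [RHS]eq_bigr do rewrite mulr_sumr.
rewrite exchange_big /=; apply: eq_bigr => J _.
have -> : mxsub f (kidx J) (A *m X) = rowsub f A *m colsub (kidx J) X.
  by apply/matrixP => i j; rewrite !mxE; apply: eq_bigr => s _; rewrite !mxE.
rewrite Cauchy_Binet mulr_suml; apply: eq_bigr => K _; rewrite -mulrA.
by congr (_ * (_ * _)); congr (\det _); apply/matrixP => i j; rewrite !mxE.
Qed.

Lemma wedge_mcomp (N : nat) (A X : 'M[R]_N) v f :
  wedge A (mcomp k X *m v) f = wedge (A *m X) v f.
Proof. by rewrite wedge_mul; apply: eq_bigr => K _; rewrite wedge_kidx. Qed.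

Lemma wedge_perm (N : nat) (X : 'M[R]_N) v f (s : 'S_k) :
  wedge X v (f \o s) = (-1) ^+ s * wedge X v f.
Proof.
rewrite mulr_sumr; apply: eq_bigr => J _; rewrite mulrA; congr (_ * _).
have -> : mxsub (f \o s) (kidx J) X = row_perm s (mxsub f (kidx J) X).
  by apply/matrixP => i j; rewrite !mxE.
by rewrite row_permE det_mulmx det_perm.
Qed.

Lemma wedgeD (N : nat) (X : 'M[R]_N) u v f : wedge X (u + v) f = wedge X u f + wedge X v f.
Proof. by rewrite -big_split; apply: eq_bigr => J _; rewrite mxE mulrDr. Qed.

Lemma wedgeZ (N : nat) (X : 'M[R]_N) a v f : wedge X (a *: v) f = a * wedge X v f.
Proof. by rewrite mulr_sumr; apply: eq_bigr => J _; rewrite mxE mulrCA. Qed.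

Lemma wedge_tangent (N : nat) (X Y : R -> 'M[R]_N) v f t : mxtangent X Y t ->
  tangent (fun s => wedge (X s) v f) (fun s => wedge (Y s) v f) t.
Proof.
move=> XY; apply: tangent_sum => J; apply: tangentM; last exact: tangent_cst.
apply: tangent_det => i j; under eq_fun do rewrite mxE.
by under [X in tangent _ X _]eq_fun do rewrite mxE; exact: XY.
Qed.

Lemma wedge_cvg (N : nat) (T : Type) (F : set_system T) {FF : Filter F}
    (X : T -> 'M[R]_N) (M : 'M[R]_N) v f :
  (forall i j, (fun s => X s i j) @ F --> M i j) ->
  (fun s => wedge (X s) v f) @ F --> wedge M v f.
Proof.
move=> XM; apply: cvg_sum_fun => J; apply: cvgM; last exact: cvg_cst.
by apply: cvg_det => i j; rewrite mxE; under eq_fun do rewrite mxE; exact: XM.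
Qed.

Variables (n m : nat).

(** All [i <= k] are allowed: when [k - i > n] or [i > m], one of the index sets is empty and the
    matrix has no entries. *)
Definition wedge_mx (i : 'I_k.+1) (X : 'M[R]_(n + m)) v :
    'M[R]_(#|{: ksub n (k - i)}|, #|{: ksub m i}|) :=
  \matrix_(I, J) wedge X v (join_idx (subnK (leq_ord i)) (kidx I) (kidx J)).

Lemma wedge_mx_block (i : 'I_k.+1) (A : 'M[R]_n) (B : 'M[R]_m) X v :
  wedge_mx i (block_mx A 0 0 B *m X) v
  = mcomp (k - i) A *m wedge_mx i X v *m (mcomp i B)^T.
Proof.
apply/matrixP => I J; rewrite -mulmxA mxE [RHS]mxE /wedge.
have E K : mxsub (join_idx (subnK (leq_ord i)) (kidx I) (kidx J)) (kidx K)
    (block_mx A 0 0 B *m X)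
  = rowsub (join_idx (subnK (leq_ord i)) (kidx I) (kidx J))
     (block_mx A 0 0 B *m colsub (kidx K) X).
  by apply/matrixP => r s; rewrite !mxE; apply: eq_bigr => u _; rewrite !mxE.
under eq_bigr do rewrite E det_block_diag_join mulr_suml.
rewrite exchange_big /=; apply: eq_bigr => I' _.
rewrite [X in _ = _ * X]mxE mulr_sumr; under eq_bigr do rewrite mulr_suml.
rewrite exchange_big /=; apply: eq_bigr => J' _.
rewrite mcompE [wedge_mx _ _ _ _ _]mxE [_^T _ _]mxE mcompE /wedge.
move: (\det (mxsub (kidx I) _ _)) (\det (mxsub (kidx J) _ _)) => a b.
rewrite mulr_suml mulr_sumr; apply: eq_bigr => K _.
have -> : rowsub (join_idx (subnK (leq_ord i)) (kidx I') (kidx J')) (colsub (kidx K) X)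
  = mxsub (join_idx (subnK (leq_ord i)) (kidx I') (kidx J')) (kidx K) X.
  by apply/matrixP => r s; rewrite !mxE.
by ring.
Qed.

Variables (p : 'I_k.+1 -> \bar R) (p1 : forall i, (1%:E <= p i)%E).

(** The block norm of [X^(k) v]. With [X] fixed it is a norm in [v], the one in which contraction is
    proved; with [v] fixed and [X] moving it is the quantity followed along a solution. *)
Definition wnorm (X : 'M[R]_(n + m)) v : R := \sum_i mxlp (p i) (wedge_mx i X v).

(** Dominates the difference of the norms whatever the exponents; it carries entrywise limits and
    tangency over to the nonsmooth [wnorm]. *)
Definition wdist (X Y : 'M[R]_(n + m)) v : R :=
  \sum_(i < k.+1) \sum_I \sum_J `|wedge_mx i X v I J - wedge_mx i Y v I J|.

Lemma wnorm_ge0 X v : 0 <= wnorm X v.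
Proof. by apply: sumr_ge0 => i _; exact: mxlp_ge0. Qed.

Lemma wnorm_le_dist X Y v : wnorm X v <= wnorm Y v + wdist X Y v.
Proof.
rewrite -big_split; apply: ler_sum => i _ /=.
have {1}-> : wedge_mx i X v = wedge_mx i Y v + (wedge_mx i X v - wedge_mx i Y v).
  by rewrite subrKC.
apply: le_trans (mxlpD (p1 i) _ _) _; rewrite lerD2l.
apply: le_trans (mxlp_le_sum (p1 i) _) _.
by apply: ler_sum => I _; apply: ler_sum => J _; rewrite !mxE.
Qed.

Lemma wedge_le_wnorm X v K : `|wedge X v (kidx K)| <= wnorm X v.
Proof.
have [i [I [J [s ->]]]] := split_ksub K.
rewrite wedge_perm normrM normrX normrN1 expr1n mul1r.
have -> : wedge X v (join_idx (subnK (leq_ord i)) (kidx I) (kidx J)) = wedge_mx i X v I J.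
  by rewrite mxE.
apply: le_trans (le_mxlp (p1 i) _ _ _) _.
rewrite /wnorm (bigD1 i) //= lerDl; apply: sumr_ge0 => j _; exact: mxlp_ge0.
Qed.

Lemma wnorm_mcomp X Y v : wnorm X (mcomp k Y *m v) = wnorm (X *m Y) v.
Proof.
apply: eq_bigr => i _; congr (mxlp _ _); apply/matrixP => I J.
by rewrite !mxE wedge_mcomp.
Qed.

Lemma wnorm_is_norm (X : 'M[R]_(n + m)) : X \in unitmx -> is_norm (wnorm X).
Proof.
move=> Xu; split=> [v|v v0|a v|u v].
- exact: wnorm_ge0.
(* The compound of the inverse of [X] recovers [v] from [X^(k) v], whose coordinates are all bounded
   by the norm. *)
- rewrite -[v]mul1mx -(mcomp1 _ (n + m) k) -(mulVmx Xu) mcomp_mul -mulmxA.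
  suff -> : mcomp k X *m v = 0 by rewrite mulmx0.
  apply/matrixP => K j; rewrite ord1 -wedge_kidx mxE; apply/eqP.
  by rewrite -normr_eq0 eq_le normr_ge0 andbT -v0 wedge_le_wnorm.
- rewrite mulr_sumr; apply: eq_bigr => i _; rewrite -mxlpZ //; congr (mxlp _ _).
  by apply/matrixP => I J; rewrite !mxE wedgeZ.
- rewrite -big_split; apply: ler_sum => i _ /=; apply: le_trans (mxlpD (p1 i) _ _).
  rewrite le_eqVlt; apply/orP; left; apply/eqP; congr (mxlp _ _).
  by apply/matrixP => I J; rewrite !mxE wedgeD.
Qed.

Lemma wnorm_cvg (T : Type) (F : set_system T) {FF : Filter F}
    (X : T -> 'M[R]_(n + m)) (M : 'M[R]_(n + m)) v :
  (forall i j, (fun s => X s i j) @ F --> M i j) ->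
  (fun s => wnorm (X s) v) @ F --> wnorm M v.
Proof.
move=> XM.
have D : (fun s => wdist M (X s) v) @ F --> (0 : R).
  have -> : 0 = \sum_(i < k.+1) \sum_I \sum_J
      `|wedge_mx i M v I J - wedge_mx i M v I J| :> R.
    by symmetry; apply: big1 => i _; apply: big1 => I _; apply: big1 => J _;
       rewrite subrr normr0.
  apply: cvg_sum_fun => i; apply: cvg_sum_fun => I; apply: cvg_sum_fun => J.
  apply: cvg_norm; apply: cvgB; first exact: cvg_cst.
  by rewrite mxE; under eq_fun do rewrite mxE; exact: wedge_cvg.
have dC X1 X2 : wdist X1 X2 v = wdist X2 X1 v.
  by apply: eq_bigr => i _; apply: eq_bigr => I _; apply: eq_bigr => J _; rewrite distrC.
apply/cvgrPdist_le => e e0; near=> s.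
have De : wdist M (X s) v <= e.
  have : `|wdist M (X s) v| <= e by near: s; exact: (cvgr0_norm_le _ D).
  by apply: le_trans; exact: ler_norm.
have h1 := wnorm_le_dist M (X s) v; have h2 := wnorm_le_dist (X s) M v.
rewrite dC in h2.
by rewrite ler_norml; apply/andP; split; lra.
Unshelve. all: by end_near. Qed.

(** By Cauchy-Binet the perturbation changes only the minors of [1 + G], each by [O(e)], and the
    coordinates they multiply are bounded by the norm itself. Hence the constant is independent of
    [X] and [v]. *)
Lemma wnorm_lipschitz : exists2 C : R, 0 <= C &
  forall (G X : 'M[R]_(n + m)) v e, 0 <= e <= 1 -> (forall i j, `|G i j| <= e) ->
  wnorm ((1%:M + G) *m X) v <= (1 + C * e) * wnorm X v.
Proof.
have [C C0 L] := det_lipschitz R k.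
pose S : R := \sum_(i < k.+1) \sum_(I < #|{: ksub n (k - i)}|)
  \sum_(J < #|{: ksub m i}|) \sum_(K < #|{: ksub (n + m) k}|) C.
exists S.
  by apply: sumr_ge0 => i _; apply: sumr_ge0 => I _; apply: sumr_ge0 => J _;
     apply: sumr_ge0.
move=> G X v e e01 Ge; apply: le_trans (wnorm_le_dist _ X v) _.
rewrite mulrDl mul1r lerD2l -mulrA mulr_suml; apply: ler_sum => i _.
rewrite mulr_suml; apply: ler_sum => I _; rewrite mulr_suml; apply: ler_sum => J _.
rewrite !mxE -[in X in _ - X](mul1mx X) !wedge_mul -sumrB mulr_suml.
apply: le_trans (ler_norm_sum _ _ _) _; apply: ler_sum => K _.
rewrite -mulrBl normrM mulrA.
apply: ler_pM => //; last exact: wedge_le_wnorm.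
set f := join_idx _ _ _.
have -> : mxsub f (kidx K) (1%:M + G) = mxsub f (kidx K) 1%:M + mxsub f (kidx K) G.
  by apply/matrixP => r s; rewrite !mxE.
apply: L => // r s; rewrite !mxE //.
by case: eqP; rewrite ?normr1 ?normr0.
Qed.

End Wedge.

(** * Growth along trajectories *)

Section Growth.
Variables (R : realType) (k n m : nat).
Variables (p : 'I_k.+1 -> \bar R) (p1 : forall i, (1%:E <= p i)%E).

Lemma near_wdist (X Y : R -> 'M[R]_(n + m)) v t e : mxtangent X Y t -> 0 < e ->
  \forall h \near 0^'+, wdist (k := k) (X (t + h)) (Y (t + h)) v <= e * h.
Proof.
move=> XY e0.
pose S : R := \sum_(i < k.+1) \sum_(I < #|{: ksub n (k - i)}|)
  \sum_(J < #|{: ksub m i}|) 1.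
have S0 : 0 <= S.
  by apply: sumr_ge0 => i _; apply: sumr_ge0 => I _; apply: sumr_ge0.
pose e' := e / (S + 1).
have e'0 : 0 < e' by rewrite divr_gt0 // ltr_wpDl.
have N : \forall h \near 0^'+, forall (i : 'I_k.+1) I J,
    `|wedge_mx i (X (t + h)) v I J - wedge_mx i (Y (t + h)) v I J| <= e' * h.
  apply: filter_forall => i; apply: filter_forall => I; apply: filter_forall => J.
  have := tangent_near (wedge_tangent v
    (join_idx (subnK (leq_ord i)) (kidx I) (kidx J)) XY) e'0.
  by apply: filterS => h; rewrite !mxE.
near=> h.
have h0 : 0 < h by near: h; exact: nbhs_right_gt.
have Nh : forall (i : 'I_k.+1) I J,
    `|wedge_mx i (X (t + h)) v I J - wedge_mx i (Y (t + h)) v I J| <= e' * h.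
  by near: h; exact: N.
apply: (@le_trans _ _ (S * (e' * h))).
  rewrite mulr_suml; apply: ler_sum => i _; rewrite mulr_suml; apply: ler_sum => I _.
  by rewrite mulr_suml; apply: ler_sum => J _; rewrite mul1r.
rewrite mulrA ler_wpM2r ?(ltW h0) // /e' mulrCA ler_piMr ?(ltW e0) //.
by rewrite ler_pdivrMr ?ltr_wpDl // mul1r lerDl.
Unshelve. all: by end_near. Qed.

Lemma near_wnorm_block_diag (A : 'M[R]_n) (B : 'M[R]_m) (X : 'M[R]_(n + m)) v b :
  (forall i : 'I_k.+1, (0 < #|{: ksub n (k - i)}|)%N -> (0 < #|{: ksub m i}|)%N ->
    mxmeasure (@lpnorm R (p i) _) (acomp (k - i) A)
    + mxmeasure (@lpnorm R (p i) _) (acomp i B) < - b) ->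
  \forall h \near 0^'+,
    wnorm p ((1%:M + h *: block_mx A 0 0 B) *m X) v <= (1 - h * b) * wnorm p X v.
Proof.
move=> mu.
have Ni (i : 'I_k.+1) : \forall h \near 0^'+,
    mxlp (p i) (wedge_mx i ((1%:M + h *: block_mx A 0 0 B) *m X) v)
    <= (1 - h * b) * mxlp (p i) (wedge_mx i X v).
  have bE h : 1%:M + h *: block_mx A 0 0 B
      = block_mx (1%:M + h *: A) 0 0 (1%:M + h *: B).
    by rewrite scalar_mx_block scale_block_mx add_block_mx !scaler0 !addr0.
  (* Empty blocks are set aside: on a space of dimension zero the identity has induced norm 0, so
     the measure carries no information. *)
  have empty W : (#|{: ksub n (k - i)}| = 0 \/ #|{: ksub m i}| = 0)%N ->
      mxlp (p i) (W : 'M[R]_(#|{: ksub n (k - i)}|, #|{: ksub m i}|)) = 0.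
    move=> E; apply/eqP; rewrite eq_le mxlp_ge0 andbT.
    apply: le_trans (mxlp_le_sum (p1 i) _) _; rewrite big1 // => I _.
    rewrite big1 // => J _; exfalso.
    case: E => E; [case: I|case: J] => u; by rewrite E.
  case: (posnP #|{: ksub n (k - i)}|) => [E|n0].
    by apply: nearW => h; rewrite !empty ?mulr0 //; left.
  case: (posnP #|{: ksub m i}|) => [E|m0].
    by apply: nearW => h; rewrite !empty ?mulr0 //; right.
  have := mu i n0 m0.
  set m1 := mxmeasure _ _; set m2 := mxmeasure _ _ => m12.
  (* One third of the slack for each of the two measures, and one third for the term of order [h^2]
     in the product of the two bounds. *)
  pose s := (- b - (m1 + m2)) / 3.
  have s0 : 0 < s by rewrite divr_gt0 // subr_gt0.
  have sE : m1 + m2 = - b - 3 * s by rewrite /s; field.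
  have l1 : m1 < m1 + s by rewrite ltrDl.
  have l2 : m2 < m2 + s by rewrite ltrDl.
  have H1 := near_indnorm_mcomp (p1 i) n0 l1.
  have H2 := near_indnorm_mcomp (p1 i) m0 l2.
  pose q := `|(m1 + s) * (m2 + s)|.
  have q0 : 0 <= q by exact: normr_ge0.
  near=> h.
  have h0 : 0 < h by near: h; exact: nbhs_right_gt.
  have hq : h <= s / (q + 1).
    by near: h; apply: nbhs_right_le; rewrite divr_gt0 // ltr_wpDl.
  have h1 : indnorm (@lpnorm R (p i) _) (mcomp (k - i) (1%:M + h *: A))
      <= 1 + h * (m1 + s) by near: h; exact: H1.
  have h2 : indnorm (@lpnorm R (p i) _) (mcomp i (1%:M + h *: B))
      <= 1 + h * (m2 + s) by near: h; exact: H2.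
  rewrite bE wedge_mx_block.
  apply: le_trans (mxlp_mulmxr (p1 i) _ _) _.
  have W0 := mxlp_ge0 (p i) (wedge_mx i X v).
  have a1 := indnorm_lp_ge0 (p1 i) (mcomp (k - i) (1%:M + h *: A)).
  have a2 := indnorm_lp_ge0 (p1 i) (mcomp i (1%:M + h *: B)).
  apply: le_trans (ler_wpM2l a2 (mxlp_mulmxl (p1 i) _ _)) _.
  rewrite mulrA; apply: ler_wpM2r => //.
  apply: le_trans (ler_pM a2 a1 h2 h1) _.
  have hs : h * ((m1 + s) * (m2 + s)) <= s.
    apply: le_trans (_ : h * q <= s).
      by rewrite ler_pM2l // ler_norm.
    rewrite ler_pdivlMr in hq; last by rewrite ltr_wpDl.
    by apply: le_trans hq; rewrite ler_pM2l // lerDl.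
  have := ler_wpM2l (ltW h0) hs.
  have -> : (1 + h * (m2 + s)) * (1 + h * (m1 + s))
     = 1 + h * (m1 + m2) + 2 * (h * s) + h * (h * ((m1 + s) * (m2 + s))) by ring.
  by rewrite sE => hh; lra.
have N : \forall h \near 0^'+, forall i : 'I_k.+1,
    mxlp (p i) (wedge_mx i ((1%:M + h *: block_mx A 0 0 B) *m X) v)
    <= (1 - h * b) * mxlp (p i) (wedge_mx i X v).
  by apply: filter_forall => i; exact: Ni.
near=> h; rewrite /wnorm mulr_sumr; apply: ler_sum => i _.
by move: i; near: h; exact: N.
Unshelve. all: by end_near. Qed.

Lemma is_derive_quadratic (a b c t : R) :
  is_derive t (1 : R) (fun s => a + (s - t) * b + (s - t) ^+ 2 * c) b.
Proof.
have -> : (fun s : R => a + (s - t) * b + (s - t) ^+ 2 * c)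
    = (fun s : R => a + (s - t) * b) + (fun s : R => (0 + (s - t) * 1) * (0 + (s - t) * c)).
  by apply/funext => s; rewrite fctE; ring.
have d1 := is_derive_affine 0 1 t; have d2 := is_derive_affine 0 c t.
apply: is_derive_eq (is_deriveD (is_derive_affine a b t) (is_deriveM d1 d2)) _.
by rewrite /= subrr !mul0r !addr0 !scale0r !addr0.
Qed.

(** The cross term of the product is quadratic in [s - t], so the two summands of the generator can
    be treated as successive factors and bounded by different means. *)
Lemma mxtangent_factor (N : nat) (Y : R -> 'M[R]_N) (G D : 'M[R]_N) t :
  (forall i j, is_derive t (1 : R) (fun s => Y s i j) (((G + D) *m Y t) i j)) ->
  mxtangent Y (fun s => (1%:M + (s - t) *: G) *m ((1%:M + (s - t) *: D) *m Y t)) t.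
Proof.
move=> dY i j; apply: tangent_trans (tangent_affine (dY i j)) _.
have E (s : R) : ((1%:M + (s - t) *: G) *m ((1%:M + (s - t) *: D) *m Y t)) i j
    = Y t i j + (s - t) * (((G + D) *m Y t) i j) + (s - t) ^+ 2 * ((G *m (D *m Y t)) i j).
  have -> : (1%:M + (s - t) *: G) *m ((1%:M + (s - t) *: D) *m Y t)
    = Y t + (s - t) *: ((G + D) *m Y t) + (s - t) ^+ 2 *: (G *m (D *m Y t)).
    have Z : (1%:M + (s - t) *: D) *m Y t = Y t + (s - t) *: (D *m Y t).
      by rewrite mulmxDl mul1mx -scalemxAl.
    rewrite Z mulmxDl mul1mx -scalemxAl mulmxDr -scalemxAr (mulmxDl G) !scalerDr.
    by rewrite scalerA -expr2 !addrA; congr (_ + _); rewrite addrAC.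
  by rewrite !mxE.
exists (((G + D) *m Y t) i j); split.
- exact: is_derive_affine.
- by under eq_fun do rewrite E; exact: is_derive_quadratic.
- by rewrite E subrr expr0n /= !mul0r !addr0.
Qed.

Lemma near_wnorm_growth (A : 'M[R]_n) (B : 'M[R]_m) (D : 'M[R]_(m, n)) (C e1 b kap : R)
    (Y : R -> 'M[R]_(n + m)) v t e :
  (forall (G X : 'M[R]_(n + m)) v e, 0 <= e <= 1 -> (forall i j, `|G i j| <= e) ->
    wnorm p ((1%:M + G) *m X) v <= (1 + C * e) * wnorm p X v) ->
  0 <= C -> 0 <= e1 -> C * e1 <= kap -> 0 <= b ->
  (forall i j, `|D i j| <= e1) ->
  (forall i : 'I_k.+1, (0 < #|{: ksub n (k - i)}|)%N -> (0 < #|{: ksub m i}|)%N ->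
    mxmeasure (@lpnorm R (p i) _) (acomp (k - i) A)
    + mxmeasure (@lpnorm R (p i) _) (acomp i B) < - b) ->
  (forall i j, is_derive t (1 : R) (fun s => Y s i j) ((block_mx A 0 D B *m Y t) i j)) ->
  0 < e ->
  \forall h \near 0^'+,
    wnorm p (Y (t + h)) v <= wnorm p (Y t) v + h * (e - (b - kap) * wnorm p (Y t) v).
Proof.
move=> L C0 e10 Ck b0 De mu dY e0.
pose G : 'M[R]_(n + m) := block_mx 0 0 D 0.
have Ge i j : `|G i j| <= e1.
  rewrite /G; case: (split_ordP i) => i' ->; case: (split_ordP j) => j' ->;
  by rewrite ?block_mxEul ?block_mxEur ?block_mxEdl ?block_mxEdr ?mxE ?normr0.
have GE : G + block_mx A 0 0 B = block_mx A 0 D B.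
  by rewrite add_block_mx !add0r addr0.
rewrite -GE in dY.
have N1 := near_wdist v (mxtangent_factor dY) e0.
have N2 := near_wnorm_block_diag (Y t) v mu.
near=> h.
have h0 : 0 < h by near: h; exact: nbhs_right_gt.
(* Gives [h * e1 <= 1], the range in which the Lipschitz bound applies. *)
have he : h <= (e1 + 1)^-1.
  by near: h; apply: nbhs_right_le; rewrite invr_gt0 ltr_wpDl.
have he1 : 0 <= h * e1 <= 1.
  rewrite mulr_ge0 ?(ltW h0) //=.
  have := he; rewrite -[_^-1]mul1r ler_pdivlMr ?ltr_wpDl // => he'.
  by apply: le_trans he'; rewrite ler_pM2l // lerDl.
have n1 : wdist (Y (t + h)) ((1%:M + h *: G) *m ((1%:M + h *: block_mx A 0 0 B) *m Y t)) v
    <= e * h.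
  have {2 3}-> : h = (t + h) - t by rewrite addrAC subrr add0r.
  by near: h; exact: N1.
have n2 : wnorm p ((1%:M + h *: block_mx A 0 0 B) *m Y t) v <= (1 - h * b) * wnorm p (Y t) v.
  by near: h; exact: N2.
apply: le_trans (wnorm_le_dist p1 _ _ v) _; apply: le_trans (lerD (lexx _) n1) _.
have hG i j : `|(h *: G) i j| <= h * e1 by rewrite mxE normrM gtr0_norm // ler_pM2l.
have := L (h *: G) ((1%:M + h *: block_mx A 0 0 B) *m Y t) v _ he1 hG.
set w := wnorm p (Y t) v in n2 *; have w0 : 0 <= w by exact: wnorm_ge0.
move=> h3.
have P0 : 0 <= 1 + C * (h * e1) by rewrite addr_ge0 // mulr_ge0 //; case/andP: he1.
have h4 := le_trans h3 (ler_wpM2l P0 n2).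
have h5 : (1 + C * (h * e1)) * ((1 - h * b) * w) <= (1 - h * (b - kap)) * w.
  rewrite [leLHS]mulrA; apply: ler_wpM2r => //.
  have q1 : h * (C * e1) <= h * kap by rewrite ler_pM2l.
  have q2 : 0 <= h * (C * e1) * (h * b) by rewrite !mulr_ge0 ?(ltW h0).
  have -> : (1 + C * (h * e1)) * (1 - h * b)
     = 1 - h * b + h * (C * e1) - h * (C * e1) * (h * b) by ring.
  lra.
have := le_trans h4 h5; rewrite mulrDl mul1r; lra.
Unshelve. all: by end_near. Qed.

End Growth.

Lemma card_ksub_gt0 (p k : nat) : (0 < #|{: ksub p k}|)%N -> (k <= p)%N.
Proof.
by move=> /card_gt0P[S _]; rewrite -(eqP (valP S)) -[leqRHS](card_ord p) max_card.
Qed.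

Lemma is_derive_mulmxl (R : realType) (m n q : nat) (T : 'M[R]_(m, n))
    (X : R -> 'M[R]_(n, q)) (D : 'M[R]_(n, q)) t :
  (forall i j, is_derive t (1 : R) (fun s => X s i j) (D i j)) ->
  forall i j, is_derive t (1 : R) (fun s => (T *m X s) i j) ((T *m D) i j).
Proof.
move=> XD i j; rewrite mxE.
have -> : (fun s => (T *m X s) i j) = \sum_r (T i r \*: (fun s => X s r j)).
  by apply/funext => s; rewrite fct_sumE mxE.
by apply: is_derive_sum => r; exact: is_deriveZ.
Qed.

Theorem theorem2 (R : realType) (n m : nat)
    (f1 : R -> 'rV[R]_n -> 'rV[R]_n)
    (f2 : R -> 'rV[R]_m -> 'rV[R]_n -> 'rV[R]_m)
    (Om1 : set 'rV[R]_n) (Om2 : set 'rV[R]_m) (k : nat) :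
  (1 <= n)%N -> (1 <= m)%N ->
  (* f^1, f^2 are C^1 (jointly in time and state) *)
  C1 (fun p : R * 'rV[R]_n => f1 p.1 p.2) ->
  C1 (fun p : R * ('rV[R]_m * 'rV[R]_n) => f2 p.1 p.2.1 p.2.2) ->
  (* the state space Omega^1 x Omega^2 is convex *)
  convex_rV (prod_set Om1 Om2) ->
  (* trajectories (from initial conditions in the state space) evolve in it *)
  (forall a, prod_set Om1 Om2 a ->
     exists z : R -> 'rV[R]_(n + m),
       [/\ z 0 = a, is_traj (series_sys f1 f2) z
         & forall t, 0 <= t -> prod_set Om1 Om2 (z t)]) ->
  (* J^{21} is uniformly bounded *)
  (exists M : R, forall (t : R) (x1 : 'rV[R]_n) (x2 : 'rV[R]_m),
     0 <= t -> Om1 x1 -> Om2 x2 ->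
     forall i j, `|pjac (fun y => f2 t x2 y) x1 i j| <= M) ->
  (1 <= k <= n + m)%N ->
  (exists (p : nat -> \bar R) (eta : nat -> R),
     forall i : nat, (maxn 0 (k - n) <= i <= minn m k)%N ->
       [/\ (1%:E <= p i)%E, 0 < eta i &
        forall (t : R) (x1 : 'rV[R]_n) (x2 : 'rV[R]_m),
          0 <= t -> Om1 x1 -> Om2 x2 ->
          mxmeasure (@lpnorm R (p i) _) (acomp (k - i) (pjac (f1 t) x1))
          + mxmeasure (@lpnorm R (p i) _) (acomp i (pjac (fun y => f2 t y x1) x2))
          <= - eta i]) ->
  k_contracting k (series_sys f1 f2) (prod_set Om1 Om2).
Proof.
move=> _ _ C1f1 C1f2 _ _ [M HM] _ [p [eta Hp]].
pose rng (i : nat) := (maxn 0 (k - n) <= i <= minn m k)%N.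
(* Outside the range the hypothesis does not constrain the exponent; any value at least 1 will do
   there, the blocks being empty. *)
pose p' (i : 'I_k.+1) := if rng i then p i else 1%:E.
have p'1 i : (1%:E <= p' i)%E.
  by rewrite /p'; case: ifP => // /Hp[].
pose eta0 : R := \big[Num.min/1]_(i < k.+1 | rng i) eta i.
have eta0_gt0 : 0 < eta0 by apply: lt_bigmin => // i /Hp[].
have eta0_le (i : 'I_k.+1) : rng i -> eta0 <= eta i.
  by move=> ri; exact: bigmin_le_cond.
have [C C0 L] := wnorm_lipschitz n m p'1.
(* The size to which the coupling is reduced, so that it costs at most [eta0 / 4] of the decay rate;
   [C + 1] keeps the denominator positive. *)
pose e1 := eta0 / (8 * (C + 1)).
have C1p : 0 < C + 1 by rewrite ltr_wpDl.
have e1p : 0 < e1 by rewrite divr_gt0 // mulr_gt0.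
have Ce1 : C * e1 <= eta0 / 4.
  rewrite /e1 mulrA ler_pdivrMr ?mulr_gt0 //.
  have : 0 <= eta0 * C by rewrite mulr_ge0 // ltW.
  lra.
pose dlt := e1 / (`|M| + 1).
have M1p : 0 < `|M| + 1 by rewrite ltr_wpDl.
have dp : 0 < dlt by rewrite divr_gt0.
(* The rescaling of the second block. It depends on [C] through [dlt], whereas [C] was obtained
   before [T]. *)
pose T : 'M[R]_(n + m) := block_mx 1%:M 0 0 dlt%:M.
have Tu : T \in unitmx.
  by rewrite unitmxE det_ublock det1 mul1r det_scalar unitfE expf_neq0 // gt_eqF.
exists (eta0 / 4); first by rewrite divr_gt0.
exists (wnorm p' T); first exact: wnorm_is_norm.
move=> a z Phi _ _ _ zD [Phi0 Phic Phid] t t0.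
apply: indnorm_le => [|v]; first exact: ltW (expR_gt0 _).
have -> : wnorm p' T v = wnorm p' (T *m Phi 0) v by rewrite Phi0 mulmx1.
rewrite wnorm_mcomp.
pose A s := pjac (f1 s) (lsubmx (z s)).
pose B s := pjac (fun y => f2 s y (lsubmx (z s))) (rsubmx (z s)).
pose D s := pjac (fun y => f2 s (rsubmx (z s)) y) (lsubmx (z s)).
(* Moving [T] across the Jacobian leaves the diagonal blocks unchanged and multiplies the coupling
   block by [dlt]. *)
have dY (s : R) : 0 < s -> forall i j, is_derive s (1 : R) (fun r => (T *m Phi r) i j)
    ((block_mx (A s) 0 (dlt *: D s) (B s) *m (T *m Phi s)) i j).
  move=> s0 i j; have := is_derive_mulmxl T (is_derive_mx (Phid s s0)) i j.
  rewrite pjac_series // mulmxA; congr (is_derive _ _ _ (_ i j)).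
  rewrite mulmxA; congr (_ *m _).
  rewrite !mulmx_block !mulmx0 !mul0mx !addr0 !add0r !mul1mx !mulmx1 !mul_scalar_mx.
  by rewrite mul_mx_scalar.
(* The measures are at most [- eta0], hence strictly below [- 3 * eta0 / 4]; the coupling costs
   [eta0 / 4], and half of the remaining [eta0 / 2] is given up to make the comparison strict. *)
apply: (dini_exp_decay (g := fun s => wnorm p' (T *m Phi s) v)
  (eta := 3 * eta0 / 4 - eta0 / 4)) => //.
- exact: wnorm_ge0.
- lra.
- apply: wnorm_cvg => // i j; rewrite mxE; under eq_fun do rewrite mxE.
  apply: cvg_sum_fun => r; apply: cvgM; first exact: cvg_cst.
  exact: cvg_mx_coord.
- move=> s s0; apply: wnorm_cvg => // i j.
  have d := @ex_derive _ _ _ _ _ _ _ (dY s s0 i j).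
  by move/derivable1_diffP : d => /differentiable_continuous.
move=> s e s0 e0; have sD := zD s (ltW s0).
apply: (near_wnorm_growth (Y := fun r => T *m Phi r) p'1 v L C0 (ltW e1p) Ce1
  _ _ _ (dY s s0) e0).
- by rewrite divr_ge0 // mulr_ge0 // ltW.
- move=> i j; rewrite mxE normrM gtr0_norm //.
  have h : `|D s i j| <= `|M| + 1.
    have := HM s _ _ (ltW s0) sD.1 sD.2 i j; rewrite -/(D s) => /le_trans; apply.
    by apply: le_trans (ler_norm M) _; rewrite lerDl.
  by apply: le_trans (ler_wpM2l (ltW dp) h) _; rewrite divfK ?gt_eqF.
(* Nonempty index sets force [k - i <= n] and [i <= m], which puts [i] in the range of the
   hypothesis. *)
- move=> i /card_ksub_gt0 in_ /card_ksub_gt0 im.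
  have ri : rng i.
    by rewrite /rng max0n leq_subLR addnC -leq_subLR in_ leq_min im -ltnS ltn_ord.
  rewrite /p' ri; have [_ _ /(_ s _ _ (ltW s0) sD.1 sD.2)] := Hp i ri.
  move=> /le_lt_trans; apply; have := eta0_le i ri; lra.
Qed.
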